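(* Let $\varepsilon>0$. Assume $c_\varepsilon(x,0)$, $x\in\mathbb{R}$, is a non-negative function of compact support with $c_\varepsilon(x,0)=0$ for $x<0$ and $0<\int_0^\infty(1+x)c_\varepsilon(x,0)\,dx<\infty$. Let $c_\varepsilon(x,t)$, $x\in\mathbb{R}$, $t>0$, be the solution with initial data $c_\varepsilon(\cdot,0)$ of the whole-line problem $$\frac{\partial c_\varepsilon}{\partial t}=\frac{\partial}{\partial x}\left\{\left[1-\frac{x}{\Lambda_\varepsilon(t)}\right]c_\varepsilon\right\}+\frac{\varepsilon}{2}\frac{\partial^2 c_\varepsilon}{\partial x^2},\quad x\in\mathbb{R},\ t>0,\qquad \Lambda_\varepsilon(t)=\frac{\int_0^\infty x\,c_\varepsilon(x,t)\,dx}{\int_0^\infty c_\varepsilon(x,t)\,dx}.$$ Let $X_{\varepsilon,t}$ be the non-negative random variable with pdf proportional to $c_\varepsilon(x,t)$, $x>0$, let $\langle X_{\varepsilon,t}\rangle$ be its mean, and let $\mathcal X$ be the exponential random variable with mean $1$. Then $X_{\varepsilon,t}/\langle X_{\varepsilon,t}\rangle$ converges in distribution to $\mathcal X$ as $t\to\infty$. In addition, $$\lim_{t\to\infty}\|\beta_{X_{\varepsilon,t}}(\cdot)-1\|_\infty=0,$$ where $\|\cdot\|_\infty$ is the supremum norm over $(0,\infty)$ and $\beta_X$ denotes the beta function of $X$.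
   Context: For a positive random variable $X$ with finite mean whose integrable pdf is proportional to a function $c_X:(0,\infty)\to[0,\infty)$, define for $x>0$ $$w_X(x)=\int_x^\infty c_X(x')\,dx',\qquad h_X(x)=\int_x^\infty w_X(x')\,dx',\qquad \beta_X(x)=\frac{c_X(x)\,h_X(x)}{w_X(x)^2}.$$ The function $\beta_X$ is the beta function of $X$ (it does not depend on the proportionality constant). *)

(* Defs.v *)
From HB Require Import structures.
From mathcomp Require Import all_boot all_order all_algebra.
From mathcomp Require Import all_classical all_reals all_analysis.
From mathcomp Require Import measurable_realfun.

Set Implicit Arguments.
Unset Strict Implicit.
Unset Printing Implicit Defensive.

Import Order.TTheory GRing.Theory Num.Theory.
Import numFieldNormedType.Exports.

Local Open Scope classical_set_scope.
Local Open Scope ring_scope.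

Definition w_of (R : realType) (c : R -> R) (x : R) : R :=
  \int[lebesgue_measure]_(y in `]x, +oo[) c y.

Definition h_of (R : realType) (c : R -> R) (x : R) : R :=
  \int[lebesgue_measure]_(y in `]x, +oo[) w_of c y.

Definition beta_of (R : realType) (c : R -> R) (x : R) : R :=
  c x * h_of c x / w_of c x ^+ 2.

(* The true supremum over (0, +oo), not the essential one; it is +oo when f is
   unbounded there. *)
Definition sup_norm (R : realType) (f : R -> R) : \bar R :=
  ereal_sup [set (`|f x|)%:E | x in `]0, +oo[].

Definition Lambda (R : realType) (c : R -> R -> R) (t : R) : R :=
  (\int[lebesgue_measure]_(x in `]0, +oo[) (x * c x t)) /
  (\int[lebesgue_measure]_(x in `]0, +oo[) c x t).

(* Classical regularity C^{2,1} on the open upper half plane. The derivatives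
   f^`() are total, so differentiability has to be required separately. *)
Definition C21 (R : realType) (c : R -> R -> R) : Prop :=
  (forall x t : R, 0 < t ->
    [/\ derivable (c x) t 1,
        derivable (c^~ t) x 1 &
        derivable ((c^~ t)^`()%classic) x 1]) /\
  (forall p : R * R, 0 < p.2 ->
    [/\ {for p, continuous (fun q : R * R => c q.1 q.2)},
        {for p, continuous (fun q : R * R => (c q.1)^`()%classic q.2)},
        {for p, continuous (fun q : R * R => (c^~ q.2)^`()%classic q.1)} &
        {for p, continuous (fun q : R * R => (c^~ q.2)^`(2)%classic q.1)}]).

(* c x t is the density at position x and time t; c x 0 is the initial datum,
   which may be any integrable function. It is attained, and the solution
   evolves, continuously in L^1(R, (1 + |x|) dx): this is the space in which
   both integrals defining Lambda are continuous functionals. Positivity of the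
   mass on the half line makes Lambda meaningful. *)
Record whole_line_solution (R : realType) (eps : R) (c : R -> R -> R) : Prop := {
  wls_C21 : C21 c;
  wls_ge0 : forall x t : R, 0 < t -> 0 <= c x t;
  wls_integrable : forall t : R, 0 < t ->
    lebesgue_measure.-integrable [set: R]
      (fun x => ((1 + `|x|) * c x t)%:E);
  wls_mass_gt0 : forall t : R, 0 < t ->
    (0 < \int[lebesgue_measure]_(x in `]0%R, +oo[) (c x t)%:E)%E;
  wls_continuous : forall t : R, 0 <= t ->
    (\int[lebesgue_measure]_x ((1 + `|x|) * `|c x s - c x t|)%:E)%E
      @[s --> within `[0, +oo[ (nbhs t)] --> 0%E;
  wls_equation : forall x t : R, 0 < t ->
    (c x)^`()%classic t =
      (fun y => (1 - y / Lambda c t) * c y t)^`()%classic x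
      + eps / 2 * (c^~ t)^`(2)%classic x
}.

Definition has_pdf_proportional d (T : measurableType d) (R : realType)
    (P : probability T R) (X : {RV P >-> R}) (c : R -> R) : Prop :=
  exists2 k : R, 0 < k &
    forall A : set R, measurable A ->
      distribution P X A =
      (\int[lebesgue_measure]_(x in A `&` `]0%R, +oo[) (k * c x)%:E)%E.

Definition is_exponential1 d (T : measurableType d) (R : realType)
    (P : probability T R) (X : {RV P >-> R}) : Prop :=
  forall A : set R, measurable A -> distribution P X A = exponential_prob 1 A.

(* The variables may live on different probability spaces. *)
Definition cvg_in_distribution (R : realType) d (T : R -> measurableType d)
    (P : forall t, probability (T t) R) (X : forall t, {RV (P t) >-> R})
    d' (T' : measurableType d') (Q : probability T' R) (Y : {RV Q >-> R}) :
    Prop :=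
  forall x : R, {for x, continuous (cdf Y)} ->
    cdf (X t) x @[t --> +oo%R] --> cdf Y x.

Definition normalized d (T : measurableType d) (R : realType)
    (P : probability T R) (X : {RV P >-> R}) : {RV P >-> R} :=
  (fine 'E_P[X])^-1 \o* X.

(* Main.v *)
(* In the variables z = x / m(t) + a(t), where m' = m / Lambda and a' = 1 / m,
   the equation becomes the heat equation run with the clock eps b(t),
   b' = 1 / m^2, so c(., t) is a rescaled Gaussian mixture with weights c(., 0).
   The representation is proved by duality: the integral of c against a Gaussian
   solving the backward equation is constant in time. As c(., 0) lives in
   [0, L], the mixture satisfies, with A = m a, S^2 = m^2 eps b,
     (x + A - m L) / S^2 c <= - dc/dx <= (x + A) / S^2 c,
   and Mills' ratio bounds applied to (c, w) and then to (w, h) give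
   |beta - 1| <= (2 eps + L) / (a - L) uniformly in x > 0, because b <= a.
   Since Lambda = h(0) / w(0), the same bounds show that m would stay bounded if
   a did, which is absurd; so a(t) -> oo. Finally (h / w)' = beta - 1 and
   (ln w)' = - beta / (h / w) turn beta -> 1 into w(r Lambda) / w(0) -> e^-r. *)
Require Import Defs.
From HB Require Import structures.
From mathcomp Require Import all_boot all_order all_algebra.
From mathcomp Require Import all_classical all_reals all_analysis.
From mathcomp Require Import measurable_realfun.
From mathcomp Require Import ring lra.

Set Implicit Arguments.
Unset Strict Implicit.
Unset Printing Implicit Defensive.

Import Order.TTheory GRing.Theory Num.Theory.
Import numFieldNormedType.Exports.

Local Open Scope classical_set_scope.
Local Open Scope ring_scope.

(** * The tail functions w and h *)

(** The solution is only known to be smooth for t > 0 and continuous at time 0 in a weighted L^1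
    space, so identifying it with a formula would call for a uniqueness theorem; testing against
    explicit Gaussians replaces one. Truncating the test function to [-r, r] costs O(1 / r): the
    drift grows like |x| while the cutoff has slope O(1 / r), and the weight 1 + |x| absorbs the
    growth. Duality needs a positive final variance, so it describes c smoothed at scale s, and c
    itself is the limit s -> 0. The two bounds on -dc/dx do not come from differentiating the
    mixture. Multiplied by exp((z - y0)^2 / 2v), every Gaussian centred on one side of y0 is
    monotone; this passes to mixtures and to the limit, and y0 = 0 and y0 = L give the two bounds.
    The bound from y0 = L has shift m (a - L), which is positive only once a > L. Hence the growth
    of a has to be derived from y0 = 0 alone, through an estimate of w(0) / h(0) that uses Mills'
    lower bound twice. *)

Lemma continuous_is_derive (R : realType) (f : R -> R) (x l : R) :
  is_derive x 1 f l -> {for x, continuous f}.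
Proof.
by case=> dfx _; apply/differentiable_continuous/derivable1_diffP.
Qed.

Lemma derivable_is_derive1 (R : realType) (f : R -> R) (x : R) :
  derivable f x 1 -> is_derive x 1 f (f^`()%classic x).
Proof. by move=> dfx; rewrite derive1E; exact/derivableP. Qed.

Lemma is_derive1E (R : realType) (f : R -> R) (x l : R) :
  is_derive x 1 f l -> f^`()%classic x = l.
Proof. by move=> dfx; rewrite derive1E derive_val. Qed.

Lemma MVT_is_derive (R : realType) (f df : R -> R) (a b : R) : a < b ->
  (forall x, a <= x <= b -> is_derive x 1 f (df x)) ->
  exists2 c, a < c < b & f b - f a = df c * (b - a).
Proof.
move=> ab dfE.
have [||c] := @MVT R f df a b ab.
- by move=> x; rewrite in_itv/= => /andP[ax xb]; apply: dfE; rewrite !ltW.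
- apply: derivable_within_continuous => x; rewrite in_itv/= => /dfE dfx.
  exact: ex_derive.
- by rewrite in_itv/= => cab fE; exists c.
Qed.

Lemma is_derive_ge0_le (R : realType) (f df : R -> R) (a b : R) : a <= b ->
  (forall x, a <= x <= b -> is_derive x 1 f (df x)) ->
  (forall x, a <= x <= b -> 0 <= df x) -> f a <= f b.
Proof.
rewrite le_eqVlt => /predU1P[->//|ab] dfE df0.
have [c /andP[ac cb] fE] := MVT_is_derive ab dfE.
by rewrite -subr_ge0 fE mulr_ge0 ?df0 ?subr_ge0 ?ltW// ac.
Qed.

Lemma is_derive_le0_le (R : realType) (f df : R -> R) (a b : R) : a <= b ->
  (forall x, a <= x <= b -> is_derive x 1 f (df x)) ->
  (forall x, a <= x <= b -> df x <= 0) -> f b <= f a.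
Proof.
move=> ab dfE df0; rewrite -lerN2.
apply: (@is_derive_ge0_le R (fun x => - f x) (fun x => - df x)) => // x xab.
  exact/is_deriveN/dfE.
by rewrite oppr_ge0 df0.
Qed.

Lemma is_derive_w_of (R : realType) (f : R -> R) (x : R) :
  continuous f ->
  (forall y, lebesgue_measure.-integrable `]y, +oo[ (EFin \o f)) ->
  is_derive x 1 (w_of f) (- f x).
Proof.
move=> cf fint.
(* Near [x] the tail is a constant minus the integral from [x - 1], to which the fundamental theorem
   of calculus applies. *)
pose F y := \int[lebesgue_measure]_(r in `]x - 1, y]) f r.
have [||||dF F'] := @continuous_FTC1 R f (BRight (x - 1)) x (x + 1).
- by rewrite ltrDl.
- by apply: integrableS (fint (x - 1)) => //; exact: subset_itvl.
- by rewrite ltEereal/= ltrBlDr ltrDl.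
- exact: cf.
apply: (@near_eq_is_derive _ _ _ (fun y => w_of f (x - 1) - F y)).
  near=> y.
  rewrite /w_of /F Rintegral_itvB//; rewrite bnd_simp.
  by apply/ltW; near: y; apply: lt_nbhsr; rewrite ltrBlDr ltrDl.
have dF1 : is_derive x 1 F (f x) by rewrite -F'; exact: derivable_is_derive1.
have := is_deriveB (is_derive_cst (w_of f (x - 1)) x 1) dF1.
by rewrite sub0r.
Unshelve. all: by end_near. Qed.

Lemma integrable_le (R : realType) (D : set R) (f g : R -> R) :
  measurable D -> measurable_fun D f ->
  (forall x, D x -> `|f x| <= g x) ->
  lebesgue_measure.-integrable D (EFin \o g) ->
  lebesgue_measure.-integrable D (EFin \o f).
Proof.
move=> mD mf fg ig; apply: le_integrable ig => //; first exact/measurable_EFinP.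
move=> x Dx; rewrite /= lee_fin (le_trans (fg _ Dx))//.
by rewrite ger0_norm// (le_trans _ (fg _ Dx)).
Qed.

Lemma integrable_scale (R : realType) (D : set R) (k : R) (f : R -> R) :
  measurable D -> lebesgue_measure.-integrable D (EFin \o f) ->
  lebesgue_measure.-integrable D (EFin \o (fun x => k * f x)).
Proof.
by move=> mD; exact: (@integrableZl _ _ _ lebesgue_measure _ _ k (EFin \o f)).
Qed.

Lemma integrable_weighted_dist (R : realType) (f g : R -> R) :
  measurable_fun [set: R] f -> measurable_fun [set: R] g ->
  (forall x, 0 <= f x) -> (forall x, 0 <= g x) ->
  lebesgue_measure.-integrable [set: R] (fun x => ((1 + `|x|) * f x)%:E) ->
  lebesgue_measure.-integrable [set: R] (fun x => ((1 + `|x|) * g x)%:E) ->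
  lebesgue_measure.-integrable [set: R]
    (EFin \o (fun x => (1 + `|x|) * `|f x - g x|)).
Proof.
move=> mf mg f0 g0 fi gi; have fgi := integrableD measurableT fi gi.
apply: (@integrable_le R setT _
  (fun x => (1 + `|x|) * f x + (1 + `|x|) * g x)) => //.
  apply: measurable_funM; first exact: measurable_funD.
  by apply: measurableT_comp => //; exact: measurable_funB.
move=> x _; rewrite ger0_norm ?mulr_ge0 ?addr_ge0//.
rewrite -mulrDr ler_wpM2l ?addr_ge0// (le_trans (ler_normB _ _))//.
by rewrite !ger0_norm.
Qed.

(** Tonelli for [f y] on the region z < x < y: the section at fixed [y] has length y - z. *)
Lemma iterated_tail_integral (R : realType) (f : R -> R) (z : R) :
  measurable_fun [set: R] f -> (forall x, 0 <= f x) ->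
  (\int[lebesgue_measure]_(x in `]z, +oo[)
     \int[lebesgue_measure]_(y in `]x, +oo[) (f y)%:E =
   \int[lebesgue_measure]_(y in `]z, +oo[) ((y - z) * f y)%:E)%E.
Proof.
move=> mf f0; pose GR := measurableTypeR R.
pose F (p : GR * GR) : \bar R := ((f p.2) * \1_`]z, p.2[ p.1)%:E.
have mF : measurable_fun setT F.
  apply/measurable_EFinP/measurable_funM; first exact: measurableT_comp.
  apply: measurable_indic.
  pose b1 (p : GR * GR) := (z < p.1)%R.
  pose b2 (p : GR * GR) := (p.1 < p.2)%R.
  rewrite [X in measurable X](_ : _ =
      b1 @^-1` [set true] `&` b2 @^-1` [set true]); last first.
    by apply/seteqP; split => p; rewrite /= in_itv/= => /andP.
  apply: measurableI.
  - have : measurable_fun setT b1 by exact: measurable_fun_ltr.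
    by move=> /(_ measurableT [set true]); rewrite setTI; exact.
  - have : measurable_fun setT b2 by exact: measurable_fun_ltr.
    by move=> /(_ measurableT [set true]); rewrite setTI; exact.
have F0 p : (0 <= F p)%E by rewrite lee_fin mulr_ge0.
transitivity
  (\int[@lebesgue_measure R]_x \int[@lebesgue_measure R]_y F (x, y))%E.
  rewrite integral_mkcond; apply: eq_integral => x _.
  rewrite patchE; case: ifPn => [|zx].
    rewrite inE/= in_itv/= andbT => zx.
    rewrite integral_mkcond; apply: eq_integral => y _.
    rewrite /F/= patchE indicE; case: ifPn => xy.
      rewrite mem_set ?mulr1//= in_itv/= zx.
      by move: xy; rewrite inE/= in_itv/= andbT.
    rewrite memNset ?mulr0//= in_itv/= zx/=.
    by move: xy; rewrite notin_setE/= in_itv/= andbT.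
  rewrite integral0_eq// => y _; rewrite /F/= indicE memNset ?mulr0//=.
  rewrite in_itv/=; apply/negP; apply: contra zx => /andP[zx _].
  by rewrite inE/= in_itv/= zx.
rewrite (fubini_tonelli F)//= [RHS]integral_mkcond; apply: eq_integral => y _.
rewrite /F/=; under eq_integral do rewrite EFinM.
rewrite ge0_integralZl//; last 2 first.
- by apply/measurable_EFinP/measurable_indic; exact: measurable_itv.
- by rewrite lee_fin.
rewrite integral_indic//= setIT lebesgue_measure_itv/= lte_fin patchE.
case: ifPn => [zy|].
  by rewrite mem_set/= ?in_itv/= ?zy// EFinM EFinB muleC.
rewrite -leNgt => yz; rewrite mule0 memNset//= in_itv/= andbT.
by apply/negP; rewrite -leNgt.
Qed.

Section tail_functions.
Context (R : realType) (f : R -> R).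
Hypotheses (mf : measurable_fun [set: R] f) (f_ge0 : forall x, 0 <= f x).
Hypothesis f_moment : lebesgue_measure.-integrable [set: R]
  (fun x => ((1 + `|x|) * f x)%:E).

Lemma integrable_moment0 : lebesgue_measure.-integrable [set: R] (EFin \o f).
Proof.
apply: integrable_le f_moment => //= x _.
by rewrite ger0_norm// ler_peMl// lerDl.
Qed.

Lemma integrable_moment1 (z : R) : lebesgue_measure.-integrable [set: R]
  (fun x => ((x - z) * f x)%:E).
Proof.
apply: integrable_le (integrable_scale (1 + `|z|) measurableT f_moment) => //.
  by apply: measurable_funM => //; exact: measurable_funB.
move=> x _ /=; rewrite mulrA normrM (ger0_norm (f_ge0 x)) ler_wpM2r//.
rewrite (le_trans (ler_normB _ _))// mulrDl mul1r mulrDr mulr1.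
have := normr_ge0 x; have := normr_ge0 z => z0 x0.
have := mulr_ge0 z0 x0; lra.
Qed.

Lemma integrable_tail (D : set R) : measurable D ->
  lebesgue_measure.-integrable D (EFin \o f).
Proof. by move=> mD; exact: integrableS integrable_moment0. Qed.

Lemma EFin_w_of (x : R) :
  (w_of f x)%:E = (\int[lebesgue_measure]_(y in `]x, +oo[) (f y)%:E)%E.
Proof.
rewrite /w_of /Rintegral fineK//.
by apply: integrable_fin_num => //; exact: integrable_tail.
Qed.

Lemma EFin_tail_moment (z : R) :
  (\int[lebesgue_measure]_(y in `]z, +oo[) ((y - z) * f y))%:E =
  (\int[lebesgue_measure]_(x in `]z, +oo[) (w_of f x)%:E)%E.
Proof.
rewrite /Rintegral fineK; last first.
  apply: integrable_fin_num => //.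
  by apply: integrableS (integrable_moment1 z).
rewrite -iterated_tail_integral//.
by apply: eq_integral => x _; rewrite EFin_w_of.
Qed.

(** At [z = 0] this identifies the first moment in [Lambda] with [h_of f 0]. *)
Lemma h_ofE (z : R) :
  h_of f z = \int[lebesgue_measure]_(y in `]z, +oo[) ((y - z) * f y).
Proof. by rewrite /h_of /Rintegral -EFin_tail_moment. Qed.

Lemma w_of_ge0 (x : R) : 0 <= w_of f x.
Proof. exact: Rintegral_ge0. Qed.

Lemma h_of_ge0 (x : R) : 0 <= h_of f x.
Proof. by apply: Rintegral_ge0 => y _; exact: w_of_ge0. Qed.

(** Markov's inequality: w(x) is at most the first moment on the half line divided by x. *)
Lemma w_of_cvg0 : w_of f x @[x --> +oo] --> 0.
Proof.
pose M := \int[lebesgue_measure]_(y in `]0, +oo[) (y * f y).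
have fM D : measurable D ->
    lebesgue_measure.-integrable D (fun y => (y * f y)%:E).
  move=> mD; apply: (@integrableS _ _ _ _ setT) => //.
  by under eq_fun do rewrite -[X in (X * _)]subr0; exact: integrable_moment1.
have wM : \forall x \near +oo, 0 <= w_of f x <= M / x.
  near=> x; rewrite w_of_ge0/=.
  have x0 : 0 < x by near: x; exact: nbhs_pinfty_gt.
  rewrite ler_pdivlMr// /w_of -RintegralZr//; last exact: integrable_tail.
  have -> : M = \int[lebesgue_measure]_(y in `]0, x]) (y * f y) +
                \int[lebesgue_measure]_(y in `]x, +oo[) (y * f y).
    rewrite /M -(@Rintegral_itvB _ _ (BRight 0) +oo%O x); last 3 first.
    - exact: fM.
    - by rewrite bnd_simp ltW.
    - by rewrite bnd_simp.
    by rewrite addrC subrK.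
  apply: ler_wpDl.
    apply: Rintegral_ge0 => y; rewrite /= in_itv/= => /andP[/ltW y0 _].
    by rewrite mulr_ge0.
  apply: le_Rintegral => //; [|exact: fM|].
    apply: (@integrableZr _ _ _ lebesgue_measure _ _ x (EFin \o f)) => //.
    exact: integrable_tail.
  by move=> y; rewrite /= in_itv/= andbT mulrC => xy; rewrite ler_wpM2r// ltW.
apply: (@squeeze_cvgr _ _ _ _ (cst 0) (fun x => M / x) _ wM).
  exact: cvg_cst.
rewrite -[X in _ --> X](mulr0 M); apply: cvgM; first exact: cvg_cst.
by apply/(@gtr0_cvgV0 _ _ _ _ id); [exact: nbhs_pinfty_gt|exact: cvg_id].
Unshelve. all: by end_near. Qed.

Hypothesis cf : continuous f.

Lemma is_derive_w (x : R) : is_derive x 1 (w_of f) (- f x).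
Proof. by apply: is_derive_w_of => // y; exact: integrable_tail. Qed.

Lemma continuous_w : continuous (w_of f).
Proof. by move=> x; exact: continuous_is_derive (is_derive_w x). Qed.

Lemma integrable_w (z : R) :
  lebesgue_measure.-integrable `]z, +oo[ (EFin \o w_of f).
Proof.
apply/integrableP; split.
  apply/measurable_EFinP/measurable_funTS.
  exact: continuous_measurable_fun continuous_w.
under eq_integral do rewrite /= ger0_norm ?w_of_ge0//.
by rewrite -EFin_tail_moment ltry.
Qed.

Lemma is_derive_h (x : R) : is_derive x 1 (h_of f) (- w_of f x).
Proof. exact: is_derive_w_of continuous_w integrable_w. Qed.

End tail_functions.

(** * Mills' ratio *)

Section is_derive_pointwise.
Context (R : realType).
Implicit Types (f g : R -> R) (x a b : R).

Lemma is_derive_addf f g x a b : is_derive x 1 f a -> is_derive x 1 g b ->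
  is_derive x 1 (fun y => f y + g y) (a + b).
Proof. exact: is_deriveD. Qed.

Lemma is_derive_oppf f x a : is_derive x 1 f a ->
  is_derive x 1 (fun y => - f y) (- a).
Proof. exact: is_deriveN. Qed.

Lemma is_derive_mulf f g x a b : is_derive x 1 f a -> is_derive x 1 g b ->
  is_derive x 1 (fun y => f y * g y) (a * g x + f x * b).
Proof.
move=> fa gb; apply: (@is_derive_eq _ _ _ _ _ _ _ _ (is_deriveM fa gb)).
by rewrite addrC [g x *: a]mulrC.
Qed.

Lemma is_derive_invf f x a : f x != 0 -> is_derive x 1 f a ->
  is_derive x 1 (fun y => (f y)^-1) (- a / f x ^+ 2).
Proof.
move=> fx fa; apply: (@is_derive_eq _ _ _ _ _ _ _ _ (is_deriveV fx fa)).
by rewrite [LHS](_ : _ = - f x ^- 2 * a)// !mulNr mulrC.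
Qed.

Lemma is_derive_expf f n x a : is_derive x 1 f a ->
  is_derive x 1 (fun y => f y ^+ n) (n%:R * f x ^+ n.-1 * a).
Proof.
move=> fa; have := is_deriveX n fa.
by rewrite (_ : f ^+ n = fun y => f y ^+ n)//; apply/funext => y; rewrite fctE.
Qed.

Lemma is_derive_expRf f x a : is_derive x 1 f a ->
  is_derive x 1 (fun y => expR (f y)) (expR (f x) * a).
Proof. by move=> fa; exact: (is_derive1_comp (is_derive_expR (f x)) fa). Qed.

Lemma is_derive_lnf f x a : 0 < f x -> is_derive x 1 f a ->
  is_derive x 1 (fun y => ln (f y)) (a / f x).
Proof.
move=> fx0 fa.
have := is_derive1_comp (is_derive1_ln fx0) fa.
by rewrite mulrC.
Qed.

Lemma is_derive_cstf (k x : R) : is_derive x 1 (fun=> k) 0.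
Proof. exact: is_derive_cst. Qed.

Lemma is_derive_idf x : is_derive x 1 (fun y => y) 1.
Proof. exact: is_derive_id. Qed.

End is_derive_pointwise.

(* The instances of the class [is_derive] are stated for sums and products in
   the ring of functions; these tactics use the pointwise rules instead. *)
Ltac is_derive_step :=
  lazymatch goal with
  | |- is_derive _ _ (fun _ => ?k) _ => notypeclasses refine (is_derive_cstf _ _)
  | |- is_derive _ _ (fun y => y) _ => notypeclasses refine (is_derive_idf _)
  | |- is_derive _ _ (fun _ => _ + _) _ =>
      notypeclasses refine (is_derive_addf _ _); is_derive_step
  | |- is_derive _ _ (fun _ => - _) _ =>
      notypeclasses refine (is_derive_oppf _); is_derive_step
  | |- is_derive _ _ (fun _ => _ * _) _ =>
      notypeclasses refine (is_derive_mulf _ _); is_derive_step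
  | |- is_derive _ _ (fun _ => _ ^-1) _ =>
      notypeclasses refine (is_derive_invf _ _); is_derive_step
  | |- is_derive _ _ (fun _ => _ ^+ _) _ =>
      notypeclasses refine (is_derive_expf _ _); is_derive_step
  | |- is_derive _ _ (fun _ => expR _) _ =>
      notypeclasses refine (is_derive_expRf _); is_derive_step
  | |- is_derive _ _ (fun _ => ln _) _ =>
      notypeclasses refine (is_derive_lnf _ _); is_derive_step
  | |- _ => idtac
  end.
Ltac is_derive_rules := notypeclasses refine (is_derive_eq _ _); [is_derive_step|].

Section mills_ratio.
Context (R : realType) (f df F : R -> R) (s a : R).
Hypotheses (s_gt0 : 0 < s) (a_gt0 : 0 < a).
Hypothesis f_ge0 : forall x, 0 <= x -> 0 <= f x.
Hypothesis F_ge0 : forall x, 0 <= x -> 0 <= F x.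
Hypothesis dfE : forall x : R, 0 <= x -> is_derive x 1 f (df x).
Hypothesis dFE : forall x : R, 0 <= x -> is_derive x 1 F (- f x).

(* [k] is the classical lower bound of Mills' ratio: [F - k f] is nonincreasing,
   and were it negative somewhere, [f] would be bounded below by a positive
   constant from there on, so that [F] would become negative. *)
Lemma mills_lower_bound (x : R) : 0 <= x ->
  (forall y, 0 <= y -> - df y <= (y + a) / s * f y) ->
  s * (x + a) * f x <= ((x + a) ^+ 2 + s) * F x.
Proof.
move=> x0 df_le; pose q y := y + a.
pose k y := s * (y + a) / ((y + a) ^+ 2 + s).
pose dk y := s * (s - q y ^+ 2) / (q y ^+ 2 + s) ^+ 2.
have q0 (y : R) : 0 <= y -> 0 < y + a by move=> y0; exact: ltr_wpDl.
have Q0 (y : R) : 0 <= y -> 0 < (y + a) ^+ 2 + s.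
  by move=> y0; rewrite ltr_wpDl// sqr_ge0.
have k0 (y : R) : 0 <= y -> 0 < k y by move=> y0; rewrite divr_gt0 ?mulr_gt0 ?Q0 ?q0.
have k_le (y : R) : 0 <= y -> k y <= s / a.
  move=> y0; rewrite /k ler_pdivrMr ?Q0// mulrAC ler_pdivlMr//.
  rewrite -mulrA ler_wpM2l ?(ltW s_gt0)// ltW//.
  apply: (@le_lt_trans _ _ ((y + a) ^+ 2)); last by rewrite ltrDl.
  by rewrite expr2 ler_wpM2l ?lerDr// ltW// q0.
have dkE (y : R) : 0 <= y -> is_derive y 1 k (dk y).
  move=> y0; have Qy := Q0 _ y0.
  have Qy' : (y + a) ^+ 2 + s != 0 by rewrite gt_eqF.
  by rewrite /k; is_derive_rules => //=; rewrite /dk /q; field.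
pose D y := F y - k y * f y.
have D_le y z : 0 <= y -> y <= z -> D z <= D y.
  move=> y0 yz.
  apply: (@is_derive_le0_le R D (fun z => - f z - (dk z * f z + k z * df z))) => //.
    move=> u /andP[yu _]; have u0 := le_trans y0 yu.
    rewrite /D; is_derive_rules; [exact: dFE|exact: dkE|exact: dfE|by []].
  move=> u /andP[yu _]; have u0 := le_trans y0 yu.
  have -> : - f u - (dk u * f u + k u * df u) =
            k u * (- df u) - (1 + dk u) * f u by ring.
  rewrite subr_le0 (le_trans (ler_wpM2l (ltW (k0 _ u0)) (df_le _ u0)))//.
  rewrite mulrA ler_wpM2r ?f_ge0// -subr_ge0.
  have Qu := Q0 _ u0; have Qu' : (u + a) ^+ 2 + s != 0 by rewrite gt_eqF.
  have s0 : s != 0 by rewrite gt_eqF.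
  (* The sign of D' reduces to k' >= k (u + a) / s - 1, which this explicit excess proves. *)
  have -> : 1 + dk u - k u * ((u + a) / s) =
            2 * s ^+ 2 / ((u + a) ^+ 2 + s) ^+ 2.
    by rewrite /k /dk /q; field; rewrite s0 Qu'.
  by apply: divr_ge0; [apply: mulr_ge0 => //|]; exact: sqr_ge0.
suff : 0 <= D x.
  rewrite subr_ge0 /k mulrAC ler_pdivrMr ?Q0//.
  by rewrite [F x * _]mulrC.
rewrite leNgt; apply/negP => Dx.
(* Beyond [x], D <= D x and F >= 0 give k f >= - D x, and k <= s / a turns this into f >= e. *)
pose e := - D x * (a / s).
have e0 : 0 < e by rewrite mulr_gt0 ?oppr_gt0 ?divr_gt0.
have f_ge y : x <= y -> e <= f y.
  move=> xy; have y0 := le_trans x0 xy.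
  have := D_le _ _ x0 xy; rewrite {1}/D => Dy.
  rewrite /e mulrA ler_pdivrMr// -ler_pdivlMr//.
  rewrite -mulrA (le_trans _ (ler_wpM2l (f_ge0 y0) (k_le _ y0)))//.
  have := F_ge0 y0; move: Dy; rewrite [f y * _]mulrC; lra.
(* Here F would be at most F x - e (y - x) = -1. *)
pose y := x + (F x + 1) / e.
have xy : x <= y by rewrite lerDl divr_ge0 ?addr_ge0 ?F_ge0// ltW.
have : F y + e * y <= F x + e * x.
  rewrite ![e * _]mulrC.
  apply: (@is_derive_le0_le R (fun z => F z + z * e)
    (fun z => - f z + (1 * e + z * 0))) => //.
    move=> u /andP[xu _]; have u0 := le_trans x0 xu.
    by is_derive_rules; [exact: dFE|].
  by move=> u /andP[xu _]; rewrite mulr0 addr0 mul1r addrC subr_le0 f_ge.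
rewrite /y mulrDr [e * (_ / e)]mulrC divfK ?gt_eqF//.
have := F_ge0 (le_trans x0 xy); rewrite /y; lra.
Qed.

(** The difference of s / (y + a) f and F is nonincreasing. Its first term is non-negative and F
    tends to 0, so it can never be negative. *)
Lemma mills_upper_bound (x : R) : 0 <= x -> F y @[y --> +oo] --> 0 ->
  (forall y, 0 <= y -> (y + a) / s * f y <= - df y) ->
  (x + a) * F x <= s * f x.
Proof.
move=> x0 Fy df_ge.
pose l y := s / (y + a).
have q0 (y : R) : 0 <= y -> 0 < y + a by move=> y0; exact: ltr_wpDl.
pose E y := l y * f y - F y.
have E_le y z : 0 <= y -> y <= z -> E z <= E y.
  move=> y0 yz.
  apply: (@is_derive_le0_le R E
    (fun z => - s / (z + a) ^+ 2 * f z + l z * df z + f z)) => //.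
    move=> u /andP[yu _]; have u0 := le_trans y0 yu.
    have qu : u + a != 0 by rewrite gt_eqF ?q0.
    rewrite /E /l; is_derive_rules; [exact: qu|exact: dfE|exact: dFE|].
    by rewrite /=; field.
  move=> u /andP[yu _]; have u0 := le_trans y0 yu.
  have qu := q0 _ u0.
  have : l u * ((u + a) / s * f u) <= l u * - df u.
    by rewrite ler_wpM2l ?df_ge// divr_ge0// ltW.
  have -> : l u * ((u + a) / s * f u) = f u.
    by rewrite /l; field; rewrite !gt_eqF.
  have : 0 <= s / (u + a) ^+ 2 * f u.
    by rewrite mulr_ge0 ?f_ge0// divr_ge0 ?sqr_ge0// ltW.
  rewrite mulNr mulNr; lra.
suff : 0 <= E x.
  by rewrite subr_ge0 /l mulrAC ler_pdivlMr ?q0// mulrC.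
rewrite leNgt; apply/negP => Ex.
near (@pinfty_nbhs R) => y.
have xy : x <= y by near: y; apply: nbhs_pinfty_ge; exact: num_real.
have y0 := le_trans x0 xy.
have Fylt : F y < - E x.
  by near: y; apply: (cvgr_lt 0) => //; rewrite oppr_gt0.
have := E_le _ _ x0 xy; rewrite {1}/E.
have : 0 <= l y * f y by rewrite mulr_ge0 ?f_ge0// divr_ge0// ltW// q0.
lra.
Unshelve. all: by end_near. Qed.

End mills_ratio.

(** * Bounds on the beta function *)

Section beta_bounds.
Context (R : realType) (f df : R -> R).
Hypotheses (cf : continuous f) (f_ge0 : forall x, 0 <= f x).
Hypothesis f_moment : lebesgue_measure.-integrable [set: R]
  (fun x => ((1 + `|x|) * f x)%:E).
Hypothesis w_gt0 : forall x, 0 < w_of f x.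

Let mf : measurable_fun [set: R] f.
Proof. exact: continuous_measurable_fun. Qed.

Let dw (x : R) : is_derive x 1 (w_of f) (- f x).
Proof. exact: is_derive_w. Qed.

Let dh (x : R) : is_derive x 1 (h_of f) (- w_of f x).
Proof. exact: is_derive_h. Qed.

Lemma is_derive_h_div_w (x : R) :
  is_derive x 1 (fun y => h_of f y / w_of f y) (beta_of f x - 1).
Proof.
have wx : w_of f x != 0 by rewrite gt_eqF.
rewrite /beta_of; is_derive_rules; [exact: dh|exact: wx|exact: dw|].
by rewrite /=; field.
Qed.

Section near_exponential.
Variables (d r : R).
Hypotheses (d_ge0 : 0 <= d) (d_lt1 : d < 1).
Hypotheses (r_gt0 : 0 < r) (dr_lt1 : d * r < 1).
Hypothesis h0_gt0 : 0 < h_of f 0.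
Hypothesis beta_near1 : forall x, 0 < x -> `|beta_of f x - 1| <= d.

(* [h / w] has derivative [beta - 1], hence is nearly constant, and
   [- (ln w)' = beta / (h / w)]. *)
Lemma tail_at_multiple_of_mean :
  expR (- (r * (1 + d) / (1 - d * r))) <=
    w_of f (r * (h_of f 0 / w_of f 0)) / w_of f 0 <=
  expR (- (r * (1 - d) / (1 + d * r))).
Proof.
pose L := h_of f 0 / w_of f 0; rewrite -/L.
have L0 : 0 < L by rewrite divr_gt0.
have dr0 : 0 < 1 - d * r by rewrite subr_gt0.
have dr1 : 0 < 1 + d * r by rewrite ltr_wpDr// mulr_ge0// ltW.
pose k y := h_of f y / w_of f y.
have kL y : 0 < y -> y <= r * L -> L * (1 - d * r) <= k y <= L * (1 + d * r).
  move=> y0 yrL.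
  have [|c /andP[c0 cy]] := @MVT_is_derive R k (fun y => beta_of f y - 1) 0 y y0.
    by move=> x _; exact: is_derive_h_div_w.
  rewrite subr0 -/L => /(canRL (subrK _)) ->.
  have := beta_near1 c0; rewrite ler_norml => /andP[b1 b2].
  have dy : d * y <= d * (r * L) by rewrite ler_wpM2l.
  have : - d * y <= (beta_of f c - 1) * y by rewrite ler_wpM2r// ltW.
  have : (beta_of f c - 1) * y <= d * y by rewrite ler_wpM2r// ltW.
  by move=> ? ?; apply/andP; split; rewrite {1}/k -/L; lra.
have rL0 : 0 < r * L by rewrite mulr_gt0.
have [|c /andP[c0 crL]] := @MVT_is_derive R (fun y => ln (w_of f y))
    (fun y => - f y / w_of f y) 0 (r * L) rL0.
  by move=> x _; is_derive_rules; [exact: w_gt0|exact: dw|].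
rewrite subr0 -lnV ?posrE// -lnM ?posrE ?invr_gt0// => lnE.
have wE : w_of f (r * L) / w_of f 0 = expR (- f c / w_of f c * (r * L)).
  by rewrite -lnE lnK// posrE divr_gt0.
have /andP[k1 k2] := kL _ c0 (ltW crL).
have k0 : 0 < k c by rewrite (lt_le_trans _ k1)// mulr_gt0.
have hE : h_of f c = k c * w_of f c by rewrite /k divfK ?gt_eqF.
have h0 : 0 < h_of f c by rewrite hE mulr_gt0.
rewrite wE !ler_expR mulNr mulNr !lerN2.
have -> : f c / w_of f c = beta_of f c / k c.
  by rewrite /beta_of hE; field; rewrite !gt_eqF.
have := beta_near1 c0; rewrite ler_norml => /andP[b1 b2].
have L1 : 0 < L * (1 - d * r) by rewrite mulr_gt0.
have L2 : 0 < L * (1 + d * r) by rewrite mulr_gt0.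
have -> : r * (1 + d) / (1 - d * r) = (1 + d) / (L * (1 - d * r)) * (r * L).
  by field; rewrite !gt_eqF.
have -> : r * (1 - d) / (1 + d * r) = (1 - d) / (L * (1 + d * r)) * (r * L).
  by field; rewrite !gt_eqF.
rewrite !(ler_pM2r rL0); apply/andP; split; apply: ler_pM.
- move: (beta_of f c) b1 b2 d_lt1 => b b1 b2 d1. lra.
- by rewrite invr_ge0 ltW.
- lra.
- by rewrite lef_pV2.
- by rewrite subr_ge0 ltW.
- by rewrite invr_ge0 ltW.
- lra.
- by rewrite lef_pV2.
Qed.

End near_exponential.

Section mills.
Variables (s A : R).
Hypothesis s_gt0 : 0 < s.
Hypothesis dfE : forall x : R, 0 <= x -> is_derive x 1 f (df x).
Hypothesis df_le : forall x, 0 <= x -> - df x <= (x + A) / s * f x.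

(** Mills' lower bound is applied to (f, w) and then to (w, h), using only the upper bound on - f'.
    Enlarging the shift to B = A + t, with t^2 = s, gives s <= t (x + B), so the first application
    yields a bound on f / w that is again linear in x, with shift B + t. The 3 comes from (A + 2t)^2
    + t^2 <= (A + 3t) (A + 2t). *)
Lemma w_le_h_at0 (t : R) : 0 <= A -> 0 < t -> s = t ^+ 2 ->
  s * w_of f 0 <= (A + 3 * t) * h_of f 0.
Proof.
move=> A0 t0 st; pose B := A + t.
have B0 : 0 < B by rewrite /B; lra.
have f_le x : 0 <= x -> f x <= (x + (B + t)) / s * w_of f x.
  move=> x0; have xB : 0 < x + B by lra.
  have := @mills_lower_bound R f df (w_of f) s B s_gt0 B0 (fun y _ => f_ge0 y)
    (fun y _ => w_of_ge0 f_ge0 y) dfE (fun y _ => dw y) x x0.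
  have le1 y : 0 <= y -> - df y <= (y + B) / s * f y.
    move=> y0; rewrite (le_trans (df_le y0))// ler_wpM2r//.
    rewrite ler_wpM2r ?invr_ge0 ?ltW//.
    by rewrite /B; lra.
  move=> /(_ le1) fx.
  rewrite mulrAC ler_pdivlMr// -(ler_pM2r xB).
  have -> : f x * s * (x + B) = s * (x + B) * f x by ring.
  rewrite (le_trans fx)// [leRHS]mulrAC ler_wpM2r ?w_of_ge0//.
  rewrite st expr2; have : t * t <= t * (x + B) by rewrite ler_wpM2l /B; lra.
  by rewrite expr2; lra.
have Bt : 0 < B + t by lra.
have h0 := h_of_ge0 f_ge0 0.
have := @mills_lower_bound R (w_of f) (fun x => - f x) (h_of f) s (B + t)
  s_gt0 Bt (fun y _ => w_of_ge0 f_ge0 y) (fun y _ => h_of_ge0 f_ge0 y)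
  (fun y _ => dw y) (fun y _ => dh y) 0 (lexx _).
have le2 y : 0 <= y -> - - f y <= (y + (B + t)) / s * w_of f y.
  by move=> y0; rewrite opprK f_le.
move=> /(_ le2); rewrite !add0r => wh.
rewrite -(ler_pM2l Bt).
have -> : (B + t) * (s * w_of f 0) = s * (B + t) * w_of f 0 by ring.
rewrite (le_trans wh)// mulrA ler_wpM2r//.
rewrite st /B expr2; have : 0 <= t * A by rewrite mulr_ge0// ltW.
by have := mulr_gt0 t0 t0; rewrite !expr2; lra.
Qed.

Variable A' : R.
Hypotheses (A'_gt0 : 0 < A') (A'_le : A' <= A).
Hypothesis df_ge : forall x, 0 <= x -> (x + A') / s * f x <= - df x.

Let A_gt0 : 0 < A. Proof. exact: lt_le_trans A'_le. Qed.

(** Write beta as (f / w) (h / w) and bound each factor on both sides by Mills' ratio at [x]. In the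
    products the factors s cancel, and what remains is worst at x = 0, which makes the bounds
    uniform. *)
Lemma beta_of_bounds (x : R) : 0 < x ->
  A' / (A + s / A) / (1 + s / A ^+ 2) <= beta_of f x <=
  (1 + s / A ^+ 2) * (A / A').
Proof.
have A'0 := A'_gt0; have A'A := A'_le; have A0 := A_gt0.
move=> x0; have xA' : 0 < x + A' by lra.
have xA : 0 < x + A by lra.
have w_le y : 0 <= y -> (y + A') * w_of f y <= s * f y.
  move=> y0; apply: (@mills_upper_bound R f df (w_of f) s A') => //.
  exact: w_of_cvg0.
have f_le y : 0 <= y -> s * (y + A) * f y <= ((y + A) ^+ 2 + s) * w_of f y.
  move=> y0; apply: (@mills_lower_bound R f df (w_of f) s A) => //.
  by move=> z _; exact: w_of_ge0.
(* For y > x the bound on w gives (x + A') w(y) <= s f(y); integrate it over the tail. *)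
have h_le : (x + A') * h_of f x <= s * w_of f x.
  rewrite mulrC -ler_pdivlMr// mulrAC /h_of /w_of -RintegralZl//; last first.
    exact: integrable_tail.
  apply: le_Rintegral => //; [exact: integrable_w| |].
    by apply: integrable_scale => //; exact: integrable_tail.
  move=> y; rewrite /= in_itv/= andbT => xy.
  have y0 : 0 <= y by rewrite (le_trans _ (ltW xy))// ltW.
  rewrite mulrAC ler_pdivlMr// mulrC (le_trans _ (w_le _ y0))//.
  by rewrite ler_wpM2r ?w_of_ge0// lerD2r ltW.
(* The bound on f / w is (y + A) / s + 1 / (y + A), at most (y + A2) / s. This is the linear form
   required to apply Mills' lower bound to (w, h). *)
pose e := s / A; pose A2 := A + e.
have e0 : 0 < e by rewrite divr_gt0.
have A20 : 0 < A2 by rewrite addr_gt0.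
have xA2 : 0 < x + A2 by lra.
have f_le2 y : 0 <= y -> f y <= (y + A2) / s * w_of f y.
  move=> y0; have yA : 0 < y + A by lra.
  rewrite mulrAC ler_pdivlMr// -(ler_pM2r yA).
  have -> : f y * s * (y + A) = s * (y + A) * f y by ring.
  rewrite (le_trans (f_le _ y0))// [leRHS]mulrAC ler_wpM2r ?w_of_ge0//.
  rewrite /A2 addrA [leRHS]mulrDl -expr2 lerD2l /e mulrAC ler_pdivlMr//.
  by rewrite ler_wpM2l; have := s_gt0; lra.
have h_ge : s * (x + A2) * w_of f x <= ((x + A2) ^+ 2 + s) * h_of f x.
  apply: (@mills_lower_bound R (w_of f) (fun x => - f x) (h_of f) s A2) => //.
  - by move=> y _; exact: w_of_ge0.
  - by move=> y _; exact: h_of_ge0.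
  - exact: ltW.
  - by move=> y y0; rewrite opprK; exact: f_le2.
have W0 := w_gt0 x; have W00 := ltW W0; have f0 := f_ge0 x.
have h0 := h_of_ge0 f_ge0 x; have s0 := ltW s_gt0.
have Q : 0 < (x + A2) ^+ 2 + s by rewrite ltr_wpDl// sqr_ge0.
apply/andP; split; last first.
  rewrite /beta_of ler_pdivrMr ?exprn_gt0//.
  apply: (@le_trans _ _ ((((x + A) ^+ 2 + s) / (s * (x + A)) * w_of f x) *
                         (s / (x + A') * w_of f x))).
    rewrite ler_pM//.
      by rewrite mulrAC ler_pdivlMr ?mulr_gt0// mulrC f_le// ltW.
    by rewrite mulrAC ler_pdivlMr// mulrC.
  have -> : ((x + A) ^+ 2 + s) / (s * (x + A)) * w_of f x *
      (s / (x + A') * w_of f x) = (1 + s / (x + A) ^+ 2) * ((x + A) / (x + A')) * w_of f x ^+ 2.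
    by field; rewrite !gt_eqF.
  rewrite ler_wpM2r ?sqr_ge0// ler_pM//.
  - by rewrite addr_ge0// divr_ge0// sqr_ge0.
  - by rewrite divr_ge0// ltW.
  - rewrite lerD2l ler_wpM2l// lef_pV2 ?posrE ?exprn_gt0//.
    by rewrite lerXn2r ?nnegrE ?ltW//; lra.
  - rewrite ler_pdivrMr// mulrAC ler_pdivlMr//.
    have : A' * x <= A * x by rewrite ler_wpM2r// ltW.
    lra.
rewrite /beta_of ler_pdivlMr ?exprn_gt0//.
apply: (@le_trans _ _ (((x + A') / s * w_of f x) *
                       (s * (x + A2) / ((x + A2) ^+ 2 + s) * w_of f x))).
  have -> : (x + A') / s * w_of f x *
      (s * (x + A2) / ((x + A2) ^+ 2 + s) * w_of f x) = ((x + A') / (x + A2)) / (1 + s / (x + A2) ^+ 2) * w_of f x ^+ 2.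
    by field; rewrite !gt_eqF.
  rewrite ler_wpM2r ?sqr_ge0// -/e -/A2 ler_pM//.
  - by rewrite divr_ge0// ltW.
  - by rewrite invr_ge0 addr_ge0// divr_ge0 ?sqr_ge0.
  - rewrite ler_pdivrMr// mulrAC ler_pdivlMr//.
    have : A' * x <= A2 * x by rewrite ler_wpM2r ?(ltW x0)// /A2; lra.
    lra.
  - rewrite lef_pV2 ?posrE ?ltr_wpDr// ?divr_ge0 ?sqr_ge0//.
    rewrite lerD2l ler_wpM2l// lef_pV2 ?posrE ?exprn_gt0//.
    by rewrite lerXn2r ?nnegrE ?ltW//; rewrite /A2; lra.
rewrite ler_pM//.
- by rewrite mulr_ge0// divr_ge0// ltW.
- by rewrite mulr_ge0// divr_ge0// ?mulr_ge0// ltW.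
- by rewrite mulrAC ler_pdivrMr// [f x * s]mulrC w_le// ltW.
- by rewrite mulrAC ler_pdivrMr// [h_of f x * _]mulrC.
Qed.

End mills.
End beta_bounds.

(** * Characteristics of the drift *)

Section continuous_pointwise.
Context (R : realType) (T : topologicalType) (p : T).
Implicit Types f g : T -> R.

Lemma continuous_addf f g : {for p, continuous f} -> {for p, continuous g} ->
  {for p, continuous (fun q => f q + g q)}.
Proof. exact: cvgD. Qed.

Lemma continuous_oppf f : {for p, continuous f} ->
  {for p, continuous (fun q => - f q)}.
Proof. exact: cvgN. Qed.

Lemma continuous_mulf f g : {for p, continuous f} -> {for p, continuous g} ->
  {for p, continuous (fun q => f q * g q)}.
Proof. exact: cvgM. Qed.

Lemma continuous_invf f : f p != 0 -> {for p, continuous f} ->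
  {for p, continuous (fun q => (f q)^-1)}.
Proof. exact: cvgV. Qed.

Lemma continuous_expf f n : {for p, continuous f} ->
  {for p, continuous (fun q => f q ^+ n)}.
Proof.
by move=> cf; exact: (continuous_comp cf (@exprn_continuous R n _)).
Qed.

Lemma continuous_compf (h : R -> R) f :
  {for p, continuous f} -> {for f p, continuous h} ->
  {for p, continuous (fun q => h (f q))}.
Proof. by move=> cf ch; exact: (continuous_comp cf ch). Qed.

Lemma continuous_expRf f : {for p, continuous f} ->
  {for p, continuous (fun q => expR (f q))}.
Proof. by move=> cf; apply: continuous_compf => //; exact: continuous_expR. Qed.

Lemma continuous_lnf f : 0 < f p -> {for p, continuous f} ->
  {for p, continuous (fun q => ln (f q))}.
Proof.
by move=> fp cf; apply: continuous_compf => //; exact: continuous_ln.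
Qed.

Lemma continuous_cstf (k : R) : {for p, continuous (fun=> k : R)}.
Proof. exact: cvg_cst. Qed.

End continuous_pointwise.

Lemma continuous_idf (R : realType) (x : R) :
  {for x, continuous (fun y : R => y)}.
Proof. exact: cvg_id. Qed.

Ltac continuous_step :=
  lazymatch goal with
  | |- {for _, continuous (fun _ => ?k)} => apply: continuous_cstf
  | |- {for _, continuous (fun y => y)} => apply: continuous_idf
  | |- {for _, continuous (fun _ => _ + _)} =>
      apply: continuous_addf; continuous_step
  | |- {for _, continuous (fun _ => - _)} =>
      apply: continuous_oppf; continuous_step
  | |- {for _, continuous (fun _ => _ * _)} =>
      apply: continuous_mulf; continuous_step
  | |- {for _, continuous (fun _ => _ ^-1)} =>
      apply: continuous_invf; continuous_step
  | |- {for _, continuous (fun _ => _ ^+ _)} =>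
      apply: continuous_expf; continuous_step
  | |- {for _, continuous (fun _ => expR _)} =>
      apply: continuous_expRf; continuous_step
  | |- {for _, continuous (fun _ => ln _)} =>
      apply: continuous_lnf; continuous_step
  | |- _ => idtac
  end.

Lemma bounded_on_compact (R : realType) (T : topologicalType) (f : T -> R)
    (A : set T) : compact A -> (forall p, A p -> {for p, continuous f}) ->
  exists2 M, 0 <= M & forall p, A p -> `|f p| <= M.
Proof.
move=> cA cf; have [A0|/set0P An0] := eqVneq A set0.
  by exists 0 => // p; rewrite A0.
have [|p _ pM] := @compact_EVT_max T R (fun q => `|f q|) A An0 cA.
  apply: continuous_in_subspaceT => q; rewrite inE => Aq.
  by apply: (continuous_comp (cf q Aq)); exact: norm_continuous.
by exists `|f p| => // q Aq; apply: pM; rewrite inE.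
Qed.

Lemma continuous_max0_id (R : realType) : continuous (fun s : R => Num.max s 0).
Proof.
move=> s; apply: (@continuous_max R R (fun x => x) (fun=> 0)).
- exact: cvg_id.
- exact: cvg_cst.
Qed.

(** Freezing negative times at 0 turns one-sided continuity on [0, +oo) into continuity on the whole
    line, so that time 0 becomes an interior point. *)
Lemma continuous_max0 (R : realType) (f : R -> R) :
  (forall t : R, 0 <= t -> f s @[s --> within `[0, +oo[ (nbhs t)] --> f t) ->
  continuous (fun s : R => f (Num.max s 0)).
Proof.
move=> cf t; apply: (cvg_comp _ _ _ (cf (Num.max t 0) _)); last first.
  by rewrite le_max lexx orbT.
have cmax := @continuous_max0_id R t.
move=> A wA; have {}cmax := cmax _ wA.
apply: (@filterS _ (nbhs t) _ _ _ _ cmax) => s; apply.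
by rewrite /= in_itv/= andbT le_max lexx orbT.
Qed.

Lemma primitive_exists (R : realType) (l : R -> R) : continuous l ->
  exists2 F : R -> R, F 0 = 0 & forall s : R, - 1 < s -> is_derive s 1 F (l s).
Proof.
move=> cl; pose G (y : R) := \int[lebesgue_measure]_(r in `[- 1, y]) l r.
have dG (s : R) : - 1 < s -> is_derive s 1 G (l s).
  move=> s1; have [||||dG <-] := @continuous_FTC1_closed R l (- 1) s (s + 1).
  - by rewrite ltrDl.
  - apply: continuous_compact_integrable; first exact: segment_compact.
    exact: continuous_subspaceT.
  - exact: s1.
  - exact: cl.
  exact: derivable_is_derive1.
exists (fun s => G s - G 0); first by rewrite subrr.
by move=> s s1; is_derive_rules; [exact: dG|rewrite addr0].
Qed.

Section flow.
Context (R : realType) (l : R -> R).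
Hypotheses (cl : continuous l) (l_gt0 : forall s, 0 < l s).

(** [l] stands for 1 / [Lambda]. Continuity and the monotonicity of [b] reach below time 0 because
    the initial time is later approached inside an open interval; the differential equations are
    only stated for s > 0. *)
Record is_flow (m a b : R -> R) : Prop := {
  flow_m0 : m 0 = 1;
  flow_a0 : a 0 = 0;
  flow_b0 : b 0 = 0;
  flow_m_gt0 : forall s, 0 < m s;
  flow_continuous : forall s : R, - 1 < s ->
    [/\ {for s, continuous m}, {for s, continuous a} & {for s, continuous b}];
  flow_is_derive : forall s : R, 0 < s ->
    [/\ is_derive s 1 m (m s * l s), is_derive s 1 a (m s)^-1 &
        is_derive s 1 b (m s ^+ 2)^-1];
  flow_m_ge1 : forall s, 0 <= s -> 1 <= m s;
  flow_a_le : forall s s', 0 <= s -> s <= s' -> a s <= a s';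
  flow_b_le : forall s s' : R, - 1 < s -> s <= s' -> b s <= b s';
  flow_b_le_a : forall s, 0 <= s -> b s <= a s
}.

Lemma flow_exists : exists m a b, is_flow m a b.
Proof.
have [M M0 dM] := primitive_exists cl.
pose m s := expR (M s).
have dm (s : R) : - 1 < s -> is_derive s 1 m (m s * l s).
  by move=> s1; rewrite /m; apply: is_derive_expRf; exact: dM.
have cm (s : R) : - 1 < s -> {for s, continuous m}.
  by move=> s1; exact: continuous_is_derive (dm s s1).
have m0 s : 0 < m s by exact: expR_gt0.
have maxN1 (s : R) : - 1 < Num.max s 0 by rewrite lt_max ltrN10 orbT.
have cmm : continuous (fun s : R => m (Num.max s 0)).
  move=> s.
  exact: (continuous_compf (@continuous_max0_id R s) (cm _ (maxN1 s))).
pose k (s : R) := (m (Num.max s 0))^-1.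
have k0 s : 0 < k s by rewrite invr_gt0.
have ck : continuous k.
  move=> s; apply: (@continuous_invf R R s (fun s => m (Num.max s 0))).
    by rewrite gt_eqF.
  exact: cmm.
have [a a0 da] := primitive_exists ck.
have ck2 : continuous (fun s => k s ^+ 2).
  by move=> s; apply: (@continuous_expf R R s k); exact: ck.
have [b b0 db] := primitive_exists ck2.
have m_ge1 (s : R) : 0 <= s -> 1 <= m s.
  move=> s0; rewrite -expR0 ler_expR -M0.
  apply: (@is_derive_ge0_le R M l) => // x /andP[x0 _]; last exact: ltW.
  by apply: dM; rewrite (lt_le_trans _ x0)// ltrN10.
have a_le (s s' : R) : - 1 < s -> s <= s' -> a s <= a s'.
  move=> s0 ss'; apply: (@is_derive_ge0_le R a k) => // x /andP[sx _].
    by apply: da; exact: lt_le_trans sx.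
  exact: ltW.
exists m, a, b; split => //.
- by rewrite /m M0 expR0.
- move=> s s1; split; first exact: cm.
    exact: continuous_is_derive (da s s1).
  exact: continuous_is_derive (db s s1).
- move=> s s0; have s1 : - 1 < s by rewrite (lt_trans _ s0)// ltrN10.
  have sE : Num.max s 0 = s by apply/max_idPl; exact: ltW.
  split; first exact: dm.
    by have := da s s1; rewrite /k sE.
  by have := db s s1; rewrite /k sE exprVn.
- by move=> s s' s0 ss'; apply: a_le => //; rewrite (lt_le_trans _ s0)// ltrN10.
- move=> s s' s1 ss'.
  apply: (@is_derive_ge0_le R b (fun x => k x ^+ 2)) => // x /andP[sx _].
    by apply: db; exact: lt_le_trans sx.
  exact: sqr_ge0.
(* Since m >= 1, b' = 1 / m^2 is at most a' = 1 / m. *)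
- move=> s s0; suff : a 0 - b 0 <= a s - b s by rewrite a0 b0 subrr subr_ge0.
  apply: (@is_derive_ge0_le R (fun x => a x - b x)
    (fun x => k x - k x ^+ 2)) => //.
    move=> x /andP[x0 _].
    have x1 : - 1 < x by rewrite (lt_le_trans _ x0)// ltrN10.
    by is_derive_step; [exact: da|exact: db].
  move=> x /andP[x0 _]; have xE : Num.max x 0 = x by apply/max_idPl.
  have k1 : k x <= 1 by rewrite /k xE invf_le1// m_ge1.
  by rewrite subr_ge0 expr2 -[leRHS]mulr1 ler_wpM2l// ltW.
Qed.

End flow.

(** * Duality with Gaussian test functions *)

Lemma Rintegral_subset (R : realType) (D : set R) (f : R -> R) :
  measurable D -> lebesgue_measure.-integrable [set: R] (EFin \o f) ->
  (forall x, 0 <= f x) ->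
  \int[lebesgue_measure]_(x in D) f x <= \int[lebesgue_measure]_x f x.
Proof.
move=> mD fi f0; apply: fine_le.
- apply: integrable_fin_num => //; exact: integrableS fi.
- exact: integrable_fin_num.
- apply: ge0_subset_integral => //.
    by case/integrableP: fi.
  by move=> x _; rewrite lee_fin.
Qed.

(* The centred Gaussian density of variance [v], times [sqrt (2 pi)]. *)
Definition heat_kernel (R : realType) (v y : R) : R :=
  expR (- (y ^+ 2 / (2 * v)) - ln v / 2).

Section duality.
Context (R : realType) (eps : R) (c : R -> R -> R).
Hypothesis eps_gt0 : 0 < eps.
Hypothesis c_C21 : C21 c.
Hypothesis c_reg : forall t, 0 <= t ->
  [/\ measurable_fun [set: R] (c^~ t), forall x, 0 <= c x t &
      lebesgue_measure.-integrable [set: R]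
        (fun x => ((1 + `|x|) * c x t)%:E)].
Context (l m a b : R -> R).
Hypothesis c_equation : forall x t : R, 0 < t ->
  (c x)^`()%classic t =
    (fun y => (1 - y * l t) * c y t)^`()%classic x
    + eps / 2 * (c^~ t)^`(2)%classic x.
Hypotheses (cl : continuous l) (l_gt0 : forall s, 0 < l s).
Hypothesis flow : is_flow l m a b.
Hypothesis c_cvg0 :
  (\int[lebesgue_measure]_x ((1 + `|x|) * `|c x s - c x 0|)%:E)%E
    @[s --> within `[0, +oo[ (nbhs (0 : R))] --> 0%E.
Variables (T beta z KL KN : R).
Hypotheses (T_gt0 : 0 < T) (beta_gt : eps * b T < beta).
Hypothesis l_le : forall s, 0 <= s -> s <= T -> l s <= KL.
Hypothesis moment_le : forall s, 0 <= s -> s <= T ->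
  \int[lebesgue_measure]_x ((1 + `|x|) * c x s) <= KN.

Let cs x s := (c x)^`()%classic s.
Let cx x s := (c^~ s)^`()%classic x.
Let cxx x s := (c^~ s)^`(2)%classic x.

Let is_derive_cs (x s : R) : 0 < s -> is_derive s 1 (c x) (cs x s).
Proof. by move=> s0; apply: derivable_is_derive1; case: (c_C21.1 x s s0). Qed.

Let is_derive_cx (x s : R) : 0 < s -> is_derive x 1 (c^~ s) (cx x s).
Proof. by move=> s0; apply: derivable_is_derive1; case: (c_C21.1 x s s0). Qed.

Let is_derive_cxx (x s : R) : 0 < s -> is_derive x 1 (cx^~ s) (cxx x s).
Proof.
move=> s0; have [_ _ dcx] := c_C21.1 x s s0.
exact: (derivable_is_derive1 dcx).
Qed.

Let csE (x s : R) : 0 < s ->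
  cs x s = - l s * c x s + (1 - x * l s) * cx x s + eps / 2 * cxx x s.
Proof.
move=> s0; rewrite /cs c_equation//; congr (_ + _).
apply: is_derive1E; is_derive_rules; [exact: is_derive_cx|].
by rewrite /=; ring.
Qed.

(** [psi] is the Gaussian test function: [q] compares [z] with the image x / m + a of [x], and [V]
    is the variance left at time [s], equal to [beta] at time 0. As q' = -(1 - x l) / m and V' = -
    eps / m^2, it solves the backward equation, whose right-hand side is [psis]. *)
Let V s := beta - eps * b s.
Let q x s := z - x / m s - a s.
Let psi x s := heat_kernel (V s) (q x s).
Let psix x s := psi x s * (q x s / (V s * m s)).
Let psixx x s :=
  psi x s * (q x s ^+ 2 / (V s * m s) ^+ 2 - (V s * m s ^+ 2)^-1).
Let psis x s := (1 - x * l s) * psix x s - eps / 2 * psixx x s.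

Let VT_gt0 : 0 < V T. Proof. by rewrite subr_gt0. Qed.

Let V_ge (s : R) : - 1 < s -> s <= T -> V T <= V s.
Proof.
by move=> s1 sT; rewrite lerD2l lerN2 ler_pM2l// (flow_b_le flow).
Qed.

Let V_gt0 (s : R) : - 1 < s -> s <= T -> 0 < V s.
Proof. by move=> s1 sT; rewrite (lt_le_trans VT_gt0)// V_ge. Qed.

Let m_gt0 (s : R) : 0 < m s. Proof. exact: flow_m_gt0 flow s. Qed.

Let Kpsi := expR (- (ln (V T) / 2)).

Let psi_ge0 x s : 0 <= psi x s. Proof. exact: expR_ge0. Qed.

Let psi_le (x s : R) : - 1 < s -> s <= T -> psi x s <= Kpsi.
Proof.
move=> s1 sT; have V0 := V_gt0 s1 sT.
rewrite /psi /heat_kernel ler_expR; apply: ler_wnDl.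
  by rewrite oppr_le0 divr_ge0 ?sqr_ge0// mulr_ge0// ltW.
by rewrite lerN2 ler_pM2r// ler_ln ?posrE ?V_ge.
Qed.

Let is_derive_psix (x s : R) : - 1 < s -> s <= T ->
  is_derive x 1 (psi^~ s) (psix x s).
Proof.
move=> s1 sT; have V0 := V_gt0 s1 sT; have m0 := m_gt0 s.
rewrite /psi /heat_kernel /q; is_derive_rules.
by rewrite /psix /psi /heat_kernel /q /=; field; rewrite !gt_eqF.
Qed.

Let is_derive_psixx (x s : R) : - 1 < s -> s <= T ->
  is_derive x 1 (psix^~ s) (psixx x s).
Proof.
move=> s1 sT; have V0 := V_gt0 s1 sT; have m0 := m_gt0 s.
rewrite /psix /q; is_derive_rules; [exact: is_derive_psix|].
by rewrite /psixx /psix /q /=; field; rewrite !gt_eqF.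
Qed.

Let is_derive_psis (x s : R) : 0 < s -> s <= T ->
  is_derive s 1 (psi x) (psis x s).
Proof.
move=> s0 sT; have s1 : - 1 < s by rewrite (lt_trans _ s0)// ltrN10.
have V0 := V_gt0 s1 sT; have m0 := m_gt0 s.
have [dm da db] := flow_is_derive flow s0.
have V2 : 2 * V s != 0 by rewrite gt_eqF// mulr_gt0.
have mn : m s != 0 by rewrite gt_eqF.
rewrite /psi /heat_kernel /q /V; is_derive_rules.
- exact: mn.
- exact: dm.
- exact: da.
- exact: V2.
- exact: db.
- exact: V0.
- exact: db.
have Vn : beta - eps * b s != 0 by rewrite gt_eqF.
rewrite /psis /psix /psixx /psi /heat_kernel /q /V /=.
by field; rewrite mn Vn.
Qed.

Let Kq := 1 + `|z| + a T.
(** The three summands bound the drift term with chi', the mixed term 2 psix chi' and the term with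
    chi'', where |chi'| <= 4 / r and |chi''| <= 8 / r. *)
Let K := 4 * (1 + KL) * Kpsi + eps / 2 * (8 * (Kpsi * (Kq / V T)) + 8 * Kpsi).

Let KL_ge0 : 0 <= KL.
Proof. by rewrite (le_trans (ltW (l_gt0 0)))// l_le// ltW. Qed.

Let aT_ge0 : 0 <= a T.
Proof. by rewrite -(flow_a0 flow) (flow_a_le flow)// ltW. Qed.

Let K_ge0 : 0 <= K.
Proof.
have Kpsi0 : 0 <= Kpsi by exact: expR_ge0.
have Kq0 : 0 <= Kq by rewrite !addr_ge0.
have KL0 := KL_ge0.
rewrite /K addr_ge0// mulr_ge0 ?divr_ge0 ?(ltW eps_gt0)//.
  by rewrite mulr_ge0// addr_ge0.
by rewrite addr_ge0 ?mulr_ge0// invr_ge0 ltW.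
Qed.

Let integrable_weight (s k : R) : 0 < s ->
  lebesgue_measure.-integrable [set: R]
    (EFin \o (fun x => k * ((1 + `|x|) * c x s))).
Proof.
by move=> s0; have [_ _ ic] := c_reg (ltW s0); exact: integrable_scale.
Qed.

Let integral_weight_le (s k : R) : 0 < s -> s <= T -> 0 <= k ->
  \int[lebesgue_measure]_x (k * ((1 + `|x|) * c x s)) <= k * KN.
Proof.
move=> s0 sT k0; have [_ _ ic] := c_reg (ltW s0).
by rewrite RintegralZl// ler_wpM2l// moment_le// ltW.
Qed.

(** * Truncation of the test function to a bounded interval *)

Section cutoff.
Variable r : R.
Hypothesis r_ge1 : 1 <= r.

Let r_gt0 : 0 < r. Proof. exact: lt_le_trans r_ge1. Qed.

(** A polynomial cutoff, used on [-r, r] only: it has double zeros at both ends, so the boundary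
    terms of two integrations by parts vanish. *)
Let chi x := (1 - (x / r) ^+ 2) ^+ 2.
Let chix x := - 4 * (x / r ^+ 2) * (1 - (x / r) ^+ 2).
Let chixx x := - 4 / r ^+ 2 + 12 * (x ^+ 2 / r ^+ 4).

Let is_derive_chi (x : R) : is_derive x 1 chi (chix x).
Proof.
by rewrite /chi; is_derive_rules; rewrite /chix /=; field; rewrite gt_eqF.
Qed.

Let is_derive_chix (x : R) : is_derive x 1 chix (chixx x).
Proof.
by rewrite /chix; is_derive_rules; rewrite /chixx /=; field; rewrite gt_eqF.
Qed.

Let g s x := c x s * psi x s * chi x.
Let gs x s := (cs x s * psi x s + c x s * psis x s) * chi x.

Let is_derive_g (x s : R) : 0 < s -> s <= T -> is_derive s 1 (g^~ x) (gs x s).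
Proof.
move=> s0 sT; rewrite /g.
is_derive_rules; [exact: is_derive_cs|exact: is_derive_psis|].
by rewrite /gs; ring.
Qed.

Let continuous_gs (p : R * R) : 0 < p.2 -> p.2 <= T ->
  {for p, continuous (fun p : R * R => gs p.1 p.2)}.
Proof.
move=> p0 pT; have p1 : - 1 < p.2 by rewrite (lt_trans _ p0)// ltrN10.
have [cc ccs _ _] := c_C21.2 p p0.
have [cm ca cb] := flow_continuous flow p1.
have c1 : {for p, continuous (fun p : R * R => p.1)} by exact: cvg_fst.
have c2 : {for p, continuous (fun p : R * R => p.2)} by exact: cvg_snd.
have cm2 := continuous_compf c2 cm.
have ca2 := continuous_compf c2 ca.
have cb2 := continuous_compf c2 cb.
have cl2 := continuous_compf c2 (@cl p.2).
have V0 := V_gt0 p1 pT; have m0 := m_gt0 p.2.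
have cpsi : {for p, continuous (fun p : R * R => psi p.1 p.2)}.
  rewrite /psi /heat_kernel /q /V; continuous_step => //; rewrite gt_eqF ?mulr_gt0//.
rewrite /gs /psis /psixx /psix /chi /q /V; continuous_step => //.
all: by rewrite gt_eqF// ?exprn_gt0 ?mulr_gt0 ?exprn_gt0.
Qed.

Let integrable_g (s : R) : 0 < s -> s <= T ->
  lebesgue_measure.-integrable `[- r, r] (EFin \o g s).
Proof.
move=> s0 sT; have s1 : - 1 < s by rewrite (lt_trans _ s0)// ltrN10.
apply: continuous_compact_integrable; first exact: segment_compact.
apply: continuous_subspaceT => x; rewrite /g.
apply: (@continuous_mulf R R x (fun x => c x s * psi x s) chi).
  apply: (@continuous_mulf R R x (c^~ s) (psi^~ s)).
    exact: continuous_is_derive (is_derive_cx x s0).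
  exact: continuous_is_derive (is_derive_psix x s1 sT).
exact: continuous_is_derive (is_derive_chi x).
Qed.

Let F s := \int[lebesgue_measure]_(x in `[- r, r]) g s x.

Let is_derive_F (s : R) : 0 < s -> s < T ->
  is_derive s 1 F (\int[lebesgue_measure]_(x in `[- r, r]) gs x s).
Proof.
(* The closed interval [u, v] surrounds [s] and stays inside (0, T), so the integrand's time
   derivative is bounded by a constant on the compact rectangle, which justifies differentiating
   under the integral. *)
move=> s0 sT; pose u := s / 2; pose v := (s + T) / 2.
have u0 : 0 < u by rewrite /u; lra.
have us : u < s by rewrite /u; lra.
have sv : s < v by rewrite /v; lra.
have vT : v <= T by rewrite /v; lra.
have [||M M0 gsM] := @bounded_on_compact R _ (fun p : R * R => gs p.1 p.2)
    (`[- r, r] `*` `[u, v]).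
- by apply: compact_setX; exact: segment_compact.
- move=> p [_ /=]; rewrite in_itv/= => /andP[up pv]; apply: continuous_gs.
    exact: lt_le_trans up.
  exact: le_trans vT.
have Is : `]u, v[%classic s by rewrite /= in_itv/= us sv.
have I_gt0 x : `]u, v[%classic x -> 0 < x /\ x <= T.
  rewrite /= in_itv/= => /andP[ux xv]; split; first exact: lt_trans ux.
  exact: (le_trans (ltW xv)).
have intg x : `]u, v[%classic x ->
    lebesgue_measure.-integrable `[- r, r] (EFin \o g x).
  by move=> /I_gt0[x0 xT]; exact: integrable_g.
have dg x y : `]u, v[%classic x -> `[- r, r]%classic y -> derivable (g^~ y) x 1.
  by move=> /I_gt0[x0 xT] _; have := is_derive_g y x0 xT => -[].
have intM : lebesgue_measure.-integrable `[- r, r] (EFin \o (fun=> M)).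
  apply: continuous_compact_integrable; first exact: segment_compact.
  by apply: continuous_subspaceT => x; exact: cvg_cst.
have gM x y : `]u, v[%classic x -> `[- r, r]%classic y ->
    `|partial1of2 g x y| <= M.
  move=> Ix Iy; have [x0 xT] := I_gt0 _ Ix.
  rewrite /partial1of2 (is_derive1E (is_derive_g y x0 xT)).
  by apply: (gsM (y, x)); split => //=; exact: subset_itv_oo_cc Ix.
have dF := @derivable_under_integral R _ _ (@lebesgue_measure R) g `[- r, r]
  (measurable_itv _) s u v Is intg dg (fun=> M) (fun=> M0) intM gM.
have F' := @differentiation_under_integral R _ _ (@lebesgue_measure R) g
  `[- r, r] (measurable_itv _) s u v Is intg dg (fun=> M) (fun=> M0) intM gM.
have -> : \int[lebesgue_measure]_(x in `[- r, r]) gs x s = F^`()%classic s.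
  rewrite F'; apply: eq_Rintegral => x _.
  by rewrite /partial1of2 (is_derive1E (is_derive_g x s0 (ltW sT))).
exact: derivable_is_derive1.
Qed.

(** This is c times the commutator of the operator - (1 - x l) d/dx + eps / 2 d^2/dx^2 with
    multiplication by [chi], applied to [psi]. *)
Let err x s := c x s * (- (1 - x * l s) * psi x s * chix x +
  eps / 2 * (2 * psix x s * chix x + psi x s * chixx x)).

(* The part of [d/ds (c psi chi)] in which [chi] is not differentiated is a
   total derivative in [x]. *)
Let B s x := (1 - x * l s) * (c x s * psi x s * chi x) +
  eps / 2 * (cx x s * psi x s * chi x -
             c x s * (psix x s * chi x + psi x s * chix x)).

Let is_derive_B (x s : R) : 0 < s -> s <= T ->
  is_derive x 1 (B s) (gs x s - err x s).
Proof.
move=> s0 sT; have s1 : - 1 < s by rewrite (lt_trans _ s0)// ltrN10.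
have dc := is_derive_cx x s0; have dcx := is_derive_cxx x s0.
have dp := is_derive_psix x s1 sT; have dpx := is_derive_psixx x s1 sT.
have dk := is_derive_chi x; have dkx := is_derive_chix x.
rewrite /B; is_derive_rules; first [exact: dc|exact: dcx|exact: dp|exact: dpx|
  exact: dk|exact: dkx|idtac].
by rewrite /gs /err csE// /psis /=; field.
Qed.

Let continuous_gs_err (x s : R) : 0 < s -> s <= T ->
  {for x, continuous (gs^~ s)} /\ {for x, continuous (err^~ s)}.
Proof.
move=> s0 sT; have s1 : - 1 < s by rewrite (lt_trans _ s0)// ltrN10.
have cc := continuous_is_derive (is_derive_cx x s0).
have cp := continuous_is_derive (is_derive_psix x s1 sT).
have cpx := continuous_is_derive (is_derive_psixx x s1 sT).
have ck := continuous_is_derive (is_derive_chi x).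
have ckx := continuous_is_derive (is_derive_chix x).
have cxs : {for x, continuous (fun x : R => (x, s))}.
  exact: (@cvg_pair R R R (nbhs x) (nbhs x) (nbhs s) _ _ _ id (cst s)
    cvg_id (cvg_cst s)).
have [_ cct _ _] := c_C21.2 (x, s) s0.
have ccs : {for x, continuous (cs^~ s)} by exact: (continuous_comp cxs cct).
have mn : m s != 0 by rewrite gt_eqF.
have Vn : V s * m s != 0 by rewrite gt_eqF// mulr_gt0// V_gt0.
split.
  by rewrite /gs /psis /psixx /q; continuous_step.
by rewrite /err /chixx; continuous_step.
Qed.

Let integrable_gs_err (s : R) : 0 < s -> s <= T ->
  lebesgue_measure.-integrable `[- r, r] (EFin \o gs^~ s) /\
  lebesgue_measure.-integrable `[- r, r] (EFin \o err^~ s).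
Proof.
move=> s0 sT; split; apply: continuous_compact_integrable;
  try exact: segment_compact; apply: continuous_subspaceT => x;
  by have [] := continuous_gs_err x s0 sT.
Qed.

Let integral_gs (s : R) : 0 < s -> s <= T ->
  \int[lebesgue_measure]_(x in `[- r, r]) gs x s =
  \int[lebesgue_measure]_(x in `[- r, r]) err x s.
Proof.
move=> s0 sT; have [igs ierr] := integrable_gs_err s0 sT.
apply/eqP; rewrite -subr_eq0 -RintegralB//; apply/eqP.
have cB x := continuous_is_derive (is_derive_B x s0 sT).
rewrite /Rintegral (@continuous_FTC2 _ _ (B s)).
- have r0 : r != 0 by rewrite gt_eqF.
  (* Every term of [B] carries [chi] or its derivative, both zero at the endpoints. *)
  have B0 x : x = r \/ x = - r -> B s x = 0.
    move=> xr; have chi0 : chi x = 0.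
      by rewrite /chi; case: xr => ->; field.
    have chix0 : chix x = 0 by rewrite /chix; case: xr => ->; field.
    by rewrite /B chi0 chix0; ring.
  by rewrite (B0 r (or_introl erefl)) (B0 (- r) (or_intror erefl)) subee.
- by rewrite ltrNl (lt_trans _ r_gt0)// oppr_lt0.
- apply: continuous_subspaceT => x; have [cg ce] := continuous_gs_err x s0 sT.
  exact: (@continuous_addf R R x (gs^~ s) _ cg (continuous_oppf ce)).
- split => [x _||].
  + by have [] := is_derive_B x s0 sT.
  + by apply: cvg_at_right_filter; exact: cB.
  + by apply: cvg_at_left_filter; exact: cB.
- by move=> x _; exact: (is_derive1E (is_derive_B x s0 sT)).
Qed.

(** Derivatives of the cutoff are O(1 / r), while the drift and [psix] grow at most linearly in x;
    the weight 1 + |x| takes up exactly that growth. *)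
Let err_le (x s : R) : 0 < s -> s <= T -> `|x| <= r ->
  `|err x s| <= K / r * ((1 + `|x|) * c x s).
Proof.
move=> s0 sT xr; have s1 : - 1 < s by rewrite (lt_trans _ s0)// ltrN10.
have [_ c0 _] := c_reg (ltW s0).
have x0 := normr_ge0 x.
pose u := (x / r) ^+ 2.
have u0 : 0 <= u by exact: sqr_ge0.
have u1 : u <= 1.
  rewrite /u -real_normK ?num_real// expr_le1//.
  by rewrite normrM normfV (gtr0_norm r_gt0) ler_pdivrMr// mul1r.
have chixE : `|chix x| <= 4 / r.
  have -> : chix x = - (4 / r * (x / r) * (1 - u)).
    by rewrite /chix /u; field; rewrite gt_eqF.
  rewrite normrN normrM -[leRHS]mulr1 ler_pM//; last by rewrite ler_norml; lra.
  rewrite normrM -[leRHS]mulr1 ler_pM//.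
    by rewrite ger0_norm// divr_ge0// ltW.
  by rewrite normrM normfV (gtr0_norm r_gt0) ler_pdivrMr// mul1r.
(* The numerator -4 + 12 u lies in [-4, 8], and 1 / r^2 <= 1 / r because r >= 1. *)
have chixxE : `|chixx x| <= 8 / r.
  have -> : chixx x = (- 4 + 12 * u) / r ^+ 2.
    by rewrite /chixx /u; field; rewrite gt_eqF.
  rewrite normrM ler_pM//; first by rewrite ler_norml; lra.
  rewrite ger0_norm ?invr_ge0 ?sqr_ge0// lef_pV2 ?posrE ?exprn_gt0//.
  by rewrite expr2 ler_peMl// ltW.
have psi0 := psi_ge0 x s; have psi1 := psi_le x s1 sT.
have l1 : `|1 - x * l s| <= (1 + KL) * (1 + `|x|).
  rewrite (le_trans (ler_normB _ _))// normr1 normrM (gtr0_norm (l_gt0 s)).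
  have : `|x| * l s <= `|x| * KL by rewrite ler_wpM2l// l_le// ltW.
  have := KL_ge0; lra.
have m1 : 1 <= m s by rewrite (flow_m_ge1 flow)// ltW.
have m_gt0' := m_gt0 s.
have q1 : `|q x s| <= Kq * (1 + `|x|).
  rewrite /q (le_trans (ler_normB _ _))//.
  rewrite (le_trans (lerD (ler_normB _ _) (lexx _)))//.
  have as0 : 0 <= a s by rewrite -(flow_a0 flow) (flow_a_le flow)// ltW.
  have asT : a s <= a T by rewrite (flow_a_le flow)// ltW.
  have xm : `|x / m s| <= `|x|.
    by rewrite normrM normfV (gtr0_norm m_gt0') ler_pdivrMr// ler_peMr.
  rewrite (ger0_norm as0) /Kq.
  have : 0 <= (`|z| + a T) * `|x| by rewrite mulr_ge0// addr_ge0.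
  by have := normr_ge0 z; lra.
have psix1 : `|psix x s| <= Kpsi * (Kq / V T) * (1 + `|x|).
  rewrite /psix normrM (ger0_norm psi0) -mulrA ler_pM//.
  have V0 := V_gt0 s1 sT.
  rewrite normrM mulrAC ler_pM// normfV gtr0_norm ?mulr_gt0//.
  rewrite lef_pV2 ?posrE ?mulr_gt0// -[leLHS]mulr1 ler_pM// ?V_ge//.
  exact: ltW.
have -> : K / r * ((1 + `|x|) * c x s) = c x s * (K / r * (1 + `|x|)) by ring.
rewrite /err normrM (ger0_norm (c0 x)) ler_wpM2l//.
have Kpsi0 : 0 <= Kpsi by exact: expR_ge0.
have t1 : `|- (1 - x * l s) * psi x s * chix x| <=
    (1 + KL) * (1 + `|x|) * Kpsi * (4 / r).
  rewrite normrM [`|_ * psi x s|]normrM normrN (ger0_norm psi0).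
  by rewrite ler_pM ?mulr_ge0// ler_pM.
have t2 : `|2 * psix x s * chix x| <=
    2 * (Kpsi * (Kq / V T) * (1 + `|x|)) * (4 / r).
  rewrite normrM [`|2 * _|]normrM (@ger0_norm _ 2)//.
  by rewrite ler_pM ?mulr_ge0// ler_pM.
have t3 : `|psi x s * chixx x| <= Kpsi * (1 + `|x|) * (8 / r).
  rewrite normrM (ger0_norm psi0) ler_pM// (le_trans psi1)// ler_peMr//.
  by rewrite lerDl.
have e2 : 0 <= eps / 2 by rewrite divr_ge0// ltW.
rewrite (le_trans (ler_normD _ _))// [`|eps / 2 * _|]normrM (ger0_norm e2).
rewrite (le_trans (lerD t1 (ler_wpM2l e2 (ler_normD _ _))))//.
rewrite (le_trans (lerD (lexx _) (ler_wpM2l e2 (lerD t2 t3))))//.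
rewrite le_eqVlt; apply/orP; left; apply/eqP.
by rewrite /K; field; rewrite !gt_eqF.
Qed.

Let norm_integral_err (s : R) : 0 < s -> s <= T ->
  `|\int[lebesgue_measure]_(x in `[- r, r]) err x s| <= K / r * KN.
Proof.
move=> s0 sT; have [_ ierr] := integrable_gs_err s0 sT.
have [_ c0 _] := c_reg (ltW s0).
have Kr0 : 0 <= K / r.
  by rewrite divr_ge0 ?(ltW r_gt0)// K_ge0.
apply: (@le_trans _ _ (\int[lebesgue_measure]_(x in `[- r, r]) `|err x s|)).
  by apply: le_normr_Rintegral => //; exact: measurable_itv.
rewrite (le_trans _ (integral_weight_le s0 sT Kr0))//.
apply: (@le_trans _ _ (\int[lebesgue_measure]_(x in `[- r, r])
    (K / r * ((1 + `|x|) * c x s)))).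
  apply: le_Rintegral => //.
  - exact: (integrable_norm ierr).
  - apply: (@integrableS _ _ _ _ setT) => //.
    exact: (integrable_weight (K / r) s0).
  - by move=> x; rewrite /= in_itv/= => xr; apply: err_le => //; rewrite ler_norml.
apply: Rintegral_subset; [exact: measurable_itv|exact: integrable_weight|].
by move=> x; rewrite mulr_ge0// mulr_ge0// addr_ge0.
Qed.

(** Removing the cutoff also costs O(1 / r): 1 - chi is at most 2 |x| / r inside [-r, r], and
    outside 1 is less than |x| / r. The first moment bounds the total. *)
Let F_near (s : R) : 0 < s -> s <= T ->
  `|\int[lebesgue_measure]_x (c x s * psi x s) - F s| <= 2 * Kpsi / r * KN.
Proof.
move=> s0 sT; have s1 : - 1 < s by rewrite (lt_trans _ s0)// ltrN10.
have [mc c0 ic] := c_reg (ltW s0).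
have Kr0 : 0 <= 2 * Kpsi / r.
  by rewrite divr_ge0 ?(ltW r_gt0)// mulr_ge0// expR_ge0.
have mpsi : measurable_fun [set: R] (psi^~ s).
  apply: continuous_measurable_fun => x.
  exact: continuous_is_derive (is_derive_psix x s1 sT).
have ip : lebesgue_measure.-integrable [set: R]
    (EFin \o (fun x => c x s * psi x s)).
  apply: integrable_le (integrable_weight Kpsi s0) => //.
    exact: measurable_funM.
  move=> x _; rewrite ger0_norm ?mulr_ge0//.
  by rewrite mulrC ler_pM ?psi_le// ler_peMl// lerDl.
have ig : lebesgue_measure.-integrable [set: R] (EFin \o (g s \_ `[- r, r])).
  rewrite -restrict_EFin; apply: (iffLR (integrable_mkcond _ _)) => //.
  exact: integrable_g.
have igB : lebesgue_measure.-integrable [set: R]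
    (EFin \o (fun x => c x s * psi x s - (g s \_ `[- r, r]) x)).
  exact: (integrableB measurableT ip ig).
have -> : F s = \int[lebesgue_measure]_x (g s \_ `[- r, r]) x.
  by rewrite /F Rintegral_mkcond.
rewrite -RintegralB// (le_trans (le_normr_Rintegral _ igB))//.
rewrite (le_trans _ (integral_weight_le s0 sT Kr0))//.
apply: le_Rintegral => //.
- exact: (integrable_norm igB).
- exact: integrable_weight.
move=> x _; have psi1 := psi_le x s1 sT; have psi0 := psi_ge0 x s.
have x0 := normr_ge0 x.
suff [k [k0 k1 ->]] : exists k, [/\ 0 <= k, k <= 2 * (`|x| / r) &
    c x s * psi x s - (g s \_ `[- r, r]) x = c x s * psi x s * k].
  rewrite ger0_norm ?mulr_ge0//.
  have -> : 2 * Kpsi / r * ((1 + `|x|) * c x s) =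
    c x s * Kpsi * (2 * ((1 + `|x|) / r)) by field; rewrite gt_eqF.
  rewrite ler_pM ?mulr_ge0 ?ler_wpM2l// (le_trans k1)// ler_wpM2l//.
  by rewrite ler_pM2r ?invr_gt0// lerDr.
rewrite patchE; case: ifPn => [|].
  rewrite inE/= in_itv/= -ler_norml => xr.
  pose u := (x / r) ^+ 2.
  have u0 : 0 <= u by exact: sqr_ge0.
  have xr1 : `|x / r| <= 1.
    by rewrite normrM normfV (gtr0_norm r_gt0) ler_pdivrMr// mul1r.
  have u1 : u <= `|x| / r.
    rewrite /u -real_normK ?num_real// expr2 -[leRHS]mulr1 ler_pM//.
    by rewrite normrM normfV (gtr0_norm r_gt0).
  have u2 : u <= 1 by rewrite /u -real_normK ?num_real// expr_le1.
  exists (2 * u - u ^+ 2); split.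
  - have : u * u <= u * 1 by rewrite ler_wpM2l.
    by rewrite expr2; lra.
  - by rewrite (@le_trans _ _ (2 * u)) ?gerBl ?sqr_ge0// ler_wpM2l.
  - by rewrite /g /chi -/u; ring.
rewrite notin_setE/= in_itv/= -ler_norml => /negP; rewrite -ltNge => rx.
exists 1; split => //; last by rewrite subr0 mulr1.
have : 1 <= `|x| / r by rewrite ler_pdivlMr// mul1r ltW.
lra.
Qed.

(** The time derivative of the truncated integral and the truncation itself are both O(1 / r), with
    constants independent of [r]; letting r grow makes the full integral constant in time. *)
Lemma integral_near (s1 s2 : R) : 0 < s1 -> s1 < s2 -> s2 < T ->
  `|\int[lebesgue_measure]_x (c x s2 * psi x s2) -
    \int[lebesgue_measure]_x (c x s1 * psi x s1)| <=
  (4 * Kpsi + K * T) * KN / r.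
Proof.
have dist3 (x1 x2 f1 f2 : R) :
    `|x2 - x1| <= `|x2 - f2| + `|f2 - f1| + `|x1 - f1|.
  rewrite [`|x1 - f1|]distrC (le_trans (ler_distD f1 _ _))// lerD2r.
  exact: ler_distD.
move=> s10 s12 s2T.
have [|t /andP[s1t ts2] FE] := @MVT_is_derive R F
  (fun s => \int[lebesgue_measure]_(x in `[- r, r]) gs x s) s1 s2 s12.
  move=> s /andP[s1s ss2]; apply: is_derive_F.
    exact: lt_le_trans s1s.
  exact: le_lt_trans s2T.
have t0 := lt_trans s10 s1t; have tT := lt_trans ts2 s2T.
have e1 := F_near s10 (ltW (lt_trans s12 s2T)).
have e2 := F_near (lt_trans s10 s12) (ltW s2T).
have e3 : `|F s2 - F s1| <= K / r * KN * T.
  have tT' := ltW tT.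
  rewrite FE /= integral_gs// normrM; apply: ler_pM => //.
    exact: norm_integral_err.
  rewrite gtr0_norm ?subr_gt0// lerBlDr (le_trans (ltW s2T))//.
  by rewrite lerDl ltW.
rewrite (le_trans (dist3 _ _ (F s1) (F s2)))//.
rewrite (le_trans (lerD (lerD e2 e3) e1))// le_eqVlt; apply/orP; left.
by apply/eqP; field; rewrite gt_eqF.
Qed.

End cutoff.
Let I s := \int[lebesgue_measure]_x (c x s * psi x s).

Let I_const (s1 s2 : R) : 0 < s1 -> s1 < s2 -> s2 < T -> I s2 = I s1.
Proof.
move=> s10 s12 s2T; apply/eqP; rewrite -subr_eq0 -normr_le0.
apply/ler_addgt0Pr => e e0.
pose C := (4 * Kpsi + K * T) * KN; rewrite add0r.
pose r := 1 + `|C| / e.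
have r1 : 1 <= r by rewrite lerDl divr_ge0// ltW.
have r0 : 0 < r by rewrite (lt_le_trans _ r1).
rewrite (le_trans (integral_near r1 s10 s12 s2T))// -/C ler_pdivrMr//.
rewrite (le_trans (ler_norm _))// /r mulrDr mulr1 [e * _]mulrC divfK ?gt_eqF//.
by rewrite lerDr ltW.
Qed.

Let integrable_c_psi (t s : R) : 0 <= t -> - 1 < s -> s <= T ->
  lebesgue_measure.-integrable [set: R] (EFin \o (fun x => c x t * psi x s)).
Proof.
move=> t0 s1 sT; have [mc c0 ic] := c_reg t0.
have mpsi : measurable_fun [set: R] (psi^~ s).
  apply: continuous_measurable_fun => x.
  exact: continuous_is_derive (is_derive_psix x s1 sT).
have ik : lebesgue_measure.-integrable [set: R]
    (EFin \o (fun x => Kpsi * ((1 + `|x|) * c x t))).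
  exact: integrable_scale.
apply: integrable_le ik => //; first exact: measurable_funM.
move=> x _; rewrite ger0_norm ?mulr_ge0//.
by rewrite mulrC ler_pM ?psi_le// ler_peMl// lerDl.
Qed.

Let J s := \int[lebesgue_measure]_x (c x 0 * psi x s).

(** Dominated convergence with the majorant [Kpsi * c x 0], on the interval (-1, T), of which 0 is
    an interior point. *)
Let continuous_J0 : {for 0, continuous J}.
Proof.
have [mc c0 ic] := c_reg (lexx 0).
have iK : lebesgue_measure.-integrable [set: R]
    (EFin \o (fun x => Kpsi * c x 0)).
  by apply: integrable_scale => //; exact: integrable_moment0.
have I0 : (0 : R) \in `]- 1, T[%classic.
  by rewrite inE/= in_itv/= T_gt0 ltrN10.
apply: (@continuity_under_integral R _ _ (@lebesgue_measure R)
  (fun s x => c x 0 * psi x s) setT measurableT (- 1) T _ _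
  (fun x => Kpsi * c x 0) iK _ 0 I0).
- move=> s; rewrite /= in_itv/= => /andP[s1 sT].
  exact: (integrable_c_psi (lexx 0) s1 (ltW sT)).
- apply/aeW => x _ s; rewrite inE/= in_itv/= => /andP[s1 sT].
  have [cm ca cb] := flow_continuous flow s1.
  have V0 := V_gt0 s1 (ltW sT); have m0 := m_gt0 s.
  suff : {for s, continuous (fun s => c x 0 * psi x s)} by [].
  rewrite /psi /heat_kernel /q /V; continuous_step => //.
    by rewrite gt_eqF.
  by rewrite gt_eqF ?mulr_gt0.
- move=> s; rewrite /= in_itv/= => /andP[s1 sT]; apply/aeW => x _.
  by rewrite ger0_norm ?mulr_ge0// mulrC ler_wpM2r// psi_le// ltW.
Qed.

Let I_J (s : R) : 0 < s -> s <= T ->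
  `|I s - J s| <=
    Kpsi * fine (\int[lebesgue_measure]_x ((1 + `|x|) * `|c x s - c x 0|)%:E)%E.
Proof.
move=> s0 sT; have s1 : - 1 < s by rewrite (lt_trans _ s0)// ltrN10.
have [mc cs0 ic] := c_reg (ltW s0); have [mc0 c00 ic0] := c_reg (lexx 0).
have i1 := integrable_c_psi (ltW s0) s1 sT.
have i2 := integrable_c_psi (lexx 0) s1 sT.
have i12 : lebesgue_measure.-integrable [set: R]
    (EFin \o (fun x => c x s * psi x s - c x 0 * psi x s)).
  exact: (integrableB measurableT i1 i2).
have id := integrable_weighted_dist mc mc0 cs0 c00 ic ic0.
rewrite /I /J -RintegralB// (le_trans (le_normr_Rintegral _ i12))//.
rewrite -[leRHS]/(Kpsi *
  \int[lebesgue_measure]_x ((1 + `|x|) * `|c x s - c x 0|)).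
rewrite -RintegralZl//; apply: le_Rintegral => //.
- exact: (integrable_norm i12).
- exact: integrable_scale.
move=> x _; rewrite -mulrBl normrM mulrC (ger0_norm (psi_ge0 _ _)).
by rewrite ler_pM ?psi_le// ler_peMl// lerDl.
Qed.

(** The equation makes [I] constant for positive times only. Time 0 is reached by replacing c(., s)
    with c(., 0): [I - J] tends to 0 by weighted L^1 continuity and [J] is continuous at 0, where m
    = 1 and a = b = 0. *)
Lemma duality (t : R) : 0 < t -> t < T ->
  \int[lebesgue_measure]_x
     (c x t * heat_kernel (beta - eps * b t) (z - x / m t - a t)) =
  \int[lebesgue_measure]_x (c x 0 * heat_kernel beta (z - x)).
Proof.
move=> t0 tT; rewrite -[LHS]/(I t).
have -> : \int[lebesgue_measure]_x (c x 0 * heat_kernel beta (z - x)) = J 0.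
  apply: eq_Rintegral => x _.
  rewrite /psi /V /q (flow_m0 flow) (flow_a0 flow) (flow_b0 flow).
  by rewrite mulr0 !subr0 divr1.
have JE : J s @[s --> 0^'+] --> J 0.
  by apply: cvg_at_right_filter; exact: continuous_J0.
have DE : fine (\int[lebesgue_measure]_x ((1 + `|x|) * `|c x s - c x 0|)%:E)%E
    @[s --> 0^'+] --> 0.
  apply: fine_cvg; apply: cvg_trans c_cvg0; apply: cvg_app.
  move=> A; rewrite /within/= => /nbhs_ballP[d d0 dA]; exists d => //= s ds s0.
  by apply: dA => //=; rewrite in_itv/= andbT ltW.
have It : I s @[s --> 0^'+] --> I t.
  apply: cvg_near_cst; near=> s.
  have s0 : 0 < s by near: s; exact: nbhs_right_gt.
  have st : s < t by near: s; exact: nbhs_right_lt.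
  by rewrite -(I_const s0 st tT).
suff IJ : (I \- J) s @[s --> 0^'+] --> 0.
  have IE : (fun s => J s + (I \- J) s) = I.
    by apply/funext => s; rewrite /= addrC subrK.
  have IJ0 : (fun s => J s + (I \- J) s) s @[s --> 0^'+] --> J 0 + 0.
    exact: (cvgD JE IJ).
  rewrite IE addr0 in IJ0.
  exact: (cvg_unique (@Rhausdorff R) It IJ0).
apply: norm_cvg0.
apply: (@squeeze_cvgr _ _ _ _ (cst 0) (fun s => Kpsi *
  fine (\int[lebesgue_measure]_x ((1 + `|x|) * `|c x s - c x 0|)%:E)%E)).
- near=> s; rewrite normr_ge0/= I_J//.
  apply: ltW; apply: lt_trans tT.
  by near: s; exact: nbhs_right_lt.
- exact: cvg_cst.
- rewrite -[X in _ --> X](mulr0 Kpsi).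
  exact: (cvgM (cvg_cst _) DE).
Unshelve. all: by end_near. Qed.

End duality.

(** * Gaussian approximate identity *)

Lemma is_derive_ge0_of_monotone (R : realType) (f : R -> R) (x l : R) :
  is_derive x 1 f l -> (forall y, 0 <= (y - x) * (f y - f x)) -> 0 <= l.
Proof.
move=> [dfx <-] mono; apply: limr_ge; first exact: dfx.
near=> h.
have h0 : h != 0 by near: h; exact: nbhs_dnbhs_neq.
rewrite [_ *: 1]mulr1; have := mono (h + x); rewrite addrK => hf.
have -> : h^-1 *: (f (h + x) - f x) = h * (f (h + x) - f x) / h ^+ 2.
  by rewrite /GRing.scale/=; field.
by rewrite divr_ge0// sqr_ge0.
Unshelve. all: by end_near. Qed.

Lemma expRN_le_inv (R : realType) (u : R) : 0 < u -> expR (- u) <= u^-1.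
Proof.
move=> u0; rewrite expRN lef_pV2 ?posrE ?expR_gt0//.
by apply/ltW/(lt_trans _ (expR_gt1Dx (lt0r_neq0 u0))); rewrite ltrDr.
Qed.

Section normal_approximation.
Context (R : realType) (f : R -> R).
Hypotheses (mf : measurable_fun [set: R] f) (f_ge0 : forall x, 0 <= f x).
Hypothesis fi : lebesgue_measure.-integrable [set: R] (EFin \o f).

Let k : R := normal_peak 1.

Lemma normal_pdf_gt0E (x s y : R) : 0 < s ->
  normal_pdf x s y = k / s * expR (- ((y - x) ^+ 2 / (2 * s ^+ 2))).
Proof.
move=> s0; rewrite normal_pdfE ?gt_eqF// /normal_fun mulNr mulr_natl.
congr (_ * _); rewrite /k /normal_peak -mulrnAr sqrtrM ?sqr_ge0//.
by rewrite sqrtr_sqr gtr0_norm// expr1n mul1r invfM mulrC.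
Qed.

Let k_ge0 : 0 <= k. Proof. exact: normal_peak_ge0. Qed.

Let int_pdf (x s g : R) : lebesgue_measure.-integrable [set: R]
  (EFin \o (fun y => g * normal_pdf x s y)).
Proof.
exact: (integrable_scale g measurableT (integrable_normal_pdf x s)).
Qed.

Lemma integrable_mul_normal (x s : R) : 0 < s ->
  lebesgue_measure.-integrable [set: R]
    (EFin \o (fun y => f y * normal_pdf x s y)).
Proof.
move=> s0; have ik : lebesgue_measure.-integrable [set: R]
    (EFin \o (fun y => normal_peak s * f y)).
  exact: integrable_scale.
apply: integrable_le ik => //.
  by apply: measurable_funM => //; exact: measurable_normal_pdf.
move=> y _; rewrite ger0_norm ?mulr_ge0 ?normal_pdf_ge0//.
by rewrite mulrC ler_wpM2r// normal_pdf_ub// gt_eqF.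
Qed.

(** Continuity handles |y - x| < d. Farther out, f(y) p(y) is at most [A] f(y) by the smallness of
    p, and f(x) p(y) is at most [B] times the normal density of doubled deviation. All majorants
    have known integrals, so no separate Gaussian tail estimate is needed. *)
Lemma normal_approximation (x e : R) : {for x, continuous f} -> 0 < e ->
  exists K, forall s, 0 < s -> s <= 1 ->
    `|\int[lebesgue_measure]_y (f y * normal_pdf x s y) - f x| <= e + K * s.
Proof.
move=> cf e0.
have /cvgrPdist_le/(_ e e0)/nbhs_ballP[d /= d0 fd] := cf.
pose M := \int[lebesgue_measure]_y f y.
pose K := 2 * k / d ^+ 2 * M + f x * (2 * (8 / (3 * d ^+ 2))).
exists K => s s0 s1.
have d2 : 0 < d ^+ 2 by rewrite exprn_gt0.
pose p := normal_pdf x s; pose p2 := normal_pdf x (2 * s).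
have p0 y : 0 <= p y by exact: normal_pdf_ge0.
have p20 y : 0 <= p2 y by exact: normal_pdf_ge0.
pose A := 2 * k / d ^+ 2 * s; pose B := f x * (2 * (8 / (3 * d ^+ 2)) * s).
have A0 : 0 <= A by rewrite mulr_ge0// ?divr_ge0 ?mulr_ge0// ltW.
have B0 : 0 <= B.
  by rewrite mulr_ge0// mulr_ge0 ?(ltW s0)// mulr_ge0// divr_ge0// mulr_ge0// ltW.
have far y : d <= `|y - x| ->
    p y <= A /\ p y <= 2 * (8 / (3 * d ^+ 2)) * s * p2 y.
  move=> dy; pose r := (y - x) ^+ 2.
  have dr : d ^+ 2 <= r.
    by rewrite /r -[r in _ <= r]real_normK ?num_real// lerXn2r ?nnegrE// ltW.
  have s2 : 0 < s ^+ 2 by rewrite exprn_gt0.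
  have r0 : 0 < r by exact: lt_le_trans dr.
  split.
    rewrite /p normal_pdf_gt0E// -/r.
    have u0 : 0 < r / (2 * s ^+ 2) by rewrite divr_gt0// mulr_gt0.
    apply: (@le_trans _ _ (k / s * (2 * s ^+ 2 / d ^+ 2))).
      rewrite ler_wpM2l ?divr_ge0 ?(ltW s0)// (le_trans (expRN_le_inv u0))//.
      rewrite invf_div ler_wpM2l ?lef_pV2 ?posrE // mulr_ge0 ?(ltW s2)//.
    rewrite le_eqVlt; apply/orP; left; apply/eqP; rewrite /A; field.
    by rewrite !gt_eqF.
  rewrite /p /p2 !normal_pdf_gt0E ?mulr_gt0// -/r.
  (* 1/2 = 3/8 + 1/8: the second factor is the exponential of the density with deviation 2s, and the
     first is O(s^2) since r >= d^2. *)
  have -> : expR (- (r / (2 * s ^+ 2))) =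
      expR (- (3 * r / (8 * s ^+ 2))) * expR (- (r / (2 * (2 * s) ^+ 2))).
    rewrite -expRD; congr expR; field.
    by rewrite gt_eqF.
  rewrite mulrA [leRHS]mulrA ler_wpM2r ?expR_ge0//.
  have u0 : 0 < 3 * r / (8 * s ^+ 2) by rewrite divr_gt0// mulr_gt0.
  apply: (@le_trans _ _ (k / s * (8 * s ^+ 2 / (3 * d ^+ 2)))).
    rewrite ler_wpM2l ?divr_ge0 ?(ltW s0)// (le_trans (expRN_le_inv u0))//.
    rewrite invf_div; apply: ler_wpM2l; first by rewrite mulr_ge0 ?(ltW s2).
    have d3 : 0 < 3 * d ^+ 2 by rewrite mulr_gt0.
    have r3 : 0 < 3 * r by rewrite mulr_gt0.
    by rewrite lef_pV2// ler_pM2l.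
  have -> : k / s * (8 * s ^+ 2 / (3 * d ^+ 2)) = 8 / (3 * d ^+ 2) * k * s.
    by field; rewrite !gt_eqF.
  have -> : 2 * (8 / (3 * d ^+ 2)) * s * (k / (2 * s)) = 8 / (3 * d ^+ 2) * k.
    by field; rewrite !gt_eqF.
  by rewrite ler_piMr// mulr_ge0// divr_ge0// mulr_ge0// ltW.
have ifp := integrable_mul_normal x s0.
have iA : lebesgue_measure.-integrable [set: R] (EFin \o (fun y => A * f y)).
  exact: integrable_scale.
have int1 (y s' g : R) :
    \int[lebesgue_measure]_r (g * normal_pdf y s' r) = g.
  rewrite RintegralZl//; last exact: integrable_normal_pdf.
  by rewrite /Rintegral integral_normal_pdf mulr1.
have -> : f x = \int[lebesgue_measure]_y (f x * p y) by rewrite int1.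
rewrite -RintegralB//; last exact: int_pdf.
have iB : lebesgue_measure.-integrable [set: R]
    (EFin \o (fun y => f y * p y - f x * p y)).
  exact: (integrableB measurableT ifp (int_pdf x s (f x))).
have iep := int_pdf x s e; have iBp := int_pdf x (2 * s) B.
have iAB : lebesgue_measure.-integrable [set: R]
    (EFin \o (fun y => A * f y + B * p2 y)).
  exact: (integrableD measurableT iA iBp).
have iS : lebesgue_measure.-integrable [set: R]
    (EFin \o (fun y => e * p y + (A * f y + B * p2 y))).
  exact: (integrableD measurableT iep iAB).
rewrite (le_trans (le_normr_Rintegral _ iB))//.
apply: (@le_trans _ _
  (\int[lebesgue_measure]_y (e * p y + (A * f y + B * p2 y)))).
  apply: le_Rintegral => //; first exact: (integrable_norm iB).
  move=> y _; rewrite -mulrBl normrM (ger0_norm (p0 y)).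
  have [yd|yd] := ltP `|x - y| d.
    have := fd _ yd; rewrite distrC => fy.
    apply: ler_wpDr; last exact: ler_wpM2r.
    by apply: addr_ge0; exact: mulr_ge0.
  rewrite distrC in yd; have [pA pB] := far y yd.
  apply: (@le_trans _ _ ((f y + f x) * p y)).
    by rewrite ler_wpM2r// (le_trans (ler_normB _ _))// !ger0_norm.
  apply: ler_wpDl; first by rewrite mulr_ge0// ltW.
  rewrite mulrDl; apply: lerD; first by rewrite mulrC ler_wpM2r.
  by rewrite /B -mulrA ler_wpM2l.
rewrite RintegralD// RintegralD// !int1 RintegralZl// -/M.
rewrite le_eqVlt; apply/orP; left; apply/eqP.
by rewrite /A /B /K; ring.
Qed.

Lemma normal_approximation_cvg (x : R) : {for x, continuous f} ->
  \int[lebesgue_measure]_y (f y * normal_pdf x s y) @[s --> 0^'+] --> f x.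
Proof.
move=> cf; apply/cvgrPdist_le => e e0.
have e2 : 0 < e / 2 by rewrite divr_gt0.
have [K HK] := normal_approximation cf e2.
near=> s.
have s0 : 0 < s by near: s; exact: nbhs_right_gt.
have s1 : s <= 1 by near: s; exact: nbhs_right_le.
rewrite distrC (le_trans (HK s s0 s1))//.
have : s <= e / 2 / (1 + `|K|).
  by near: s; apply: nbhs_right_le; rewrite divr_gt0// ltr_pwDl.
rewrite ler_pdivlMr ?ltr_pwDl// mulrDr mulr1 => sK.
have : K * s <= `|K| * s by rewrite ler_wpM2r ?ler_norm// ltW.
by rewrite [`|K| * s]mulrC; lra.
Unshelve. all: by end_near. Qed.

End normal_approximation.

Lemma heat_kernel_scaled (R : realType) (m s x y : R) : 0 < m -> 0 < s ->
  heat_kernel ((s / m) ^+ 2) ((x - y) / m) =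
  m / normal_peak 1 * normal_pdf x s y.
Proof.
move=> m0 s0; have k0 : 0 < normal_peak (1 : R) by exact: normal_peak_gt0.
have sm0 : 0 < s / m by rewrite divr_gt0.
rewrite normal_pdf_gt0E// /heat_kernel expRD lnXn// -[X in X / 2]mulr_natr.
rewrite mulfK ?pnatr_eq0// -lnV ?posrE// lnK ?posrE ?invr_gt0//.
have -> : ((x - y) / m) ^+ 2 / (2 * (s / m) ^+ 2) = (y - x) ^+ 2 / (2 * s ^+ 2).
  by field; rewrite !gt_eqF.
by field; rewrite !gt_eqF.
Qed.

(* [exp ((z - y0)^2 / 2v) heat_kernel v (z - y)] is the exponential of an affine
   function of [z] of slope [(y - y0) / v]. *)
Lemma heat_kernel_monotone (R : realType) (v y0 y z1 z2 : R) : 0 < v ->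
  0 <= (y - y0) * (z2 - z1) ->
  expR ((z1 - y0) ^+ 2 / (2 * v)) * heat_kernel v (z1 - y) <=
  expR ((z2 - y0) ^+ 2 / (2 * v)) * heat_kernel v (z2 - y).
Proof.
move=> v0 yz; rewrite /heat_kernel -!expRD ler_expR -subr_ge0.
have -> : (z2 - y0) ^+ 2 / (2 * v) + (- ((z2 - y) ^+ 2 / (2 * v)) - ln v / 2) -
  ((z1 - y0) ^+ 2 / (2 * v) + (- ((z1 - y) ^+ 2 / (2 * v)) - ln v / 2)) =
  (y - y0) * (z2 - z1) / v.
  by field; rewrite gt_eqF.
by rewrite divr_ge0// ltW.
Qed.

(** * Integrals against a non-negative weight *)

Section weights.
Context (R : realType) (D : set R) (g : R -> R).
Hypotheses (mD : measurable D) (mg : measurable_fun [set: R] g).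
Hypothesis g_ge0 : forall x, 0 <= g x.

(** If the integral of v g vanished, positivity of v would force g = 0 almost everywhere on D, and
    the integral of u g would vanish too. *)
Lemma weighted_integral_gt0 (u v : R -> R) :
  measurable_fun [set: R] u -> measurable_fun [set: R] v ->
  (forall x, D x -> 0 <= u x) -> (forall x, D x -> 0 < v x) ->
  (0 < \int[lebesgue_measure]_(x in D) (u x * g x)%:E)%E ->
  (0 < \int[lebesgue_measure]_(x in D) (v x * g x)%:E)%E.
Proof.
move=> mu mv u0 v0; rewrite lt_neqAle => /andP[+ _].
have vg0 x : D x -> (0 <= (v x * g x)%:E)%E.
  by move=> Dx; rewrite lee_fin mulr_ge0// ltW// v0.
rewrite lt_neqAle integral_ge0// andbT; apply: contra => /eqP vg.
have mvg : measurable_fun D (fun x => (v x * g x)%:E).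
  by apply/measurable_EFinP/measurable_funTS/measurable_funM.
have mug : measurable_fun D (fun x => (u x * g x)%:E).
  by apply/measurable_EFinP/measurable_funTS/measurable_funM.
have vg_abs : (\int[lebesgue_measure]_(x in D) `|(v x * g x)%:E| = 0)%E.
  rewrite vg; apply: eq_integral => x; rewrite inE => Dx.
  by rewrite /= ger0_norm// mulr_ge0// ltW// v0.
have vg_ae :=
  iffLR (@ae_eq_integral_abs _ _ _ (@lebesgue_measure R) D mD _ mvg) vg_abs.
have ug_ae : ae_eq lebesgue_measure D (fun x => (u x * g x)%:E) (cst 0%E).
  apply: filterS vg_ae => x vgx Dx; have /eqP := vgx Dx.
  rewrite eqe mulf_eq0 gt_eqF ?v0//= => /eqP ->.
  by rewrite mulr0.
have ug_abs :=
  iffRL (@ae_eq_integral_abs _ _ _ (@lebesgue_measure R) D mD _ mug) ug_ae.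
apply/eqP; rewrite -ug_abs; apply: eq_integral => x; rewrite inE => Dx.
by rewrite /= ger0_norm// mulr_ge0// u0.
Qed.

End weights.

(** As |u| <= 1 + |x|, the two integrals differ by at most the weighted L^1 distance between c(., s)
    and c(., t). *)
Lemma weighted_integral_continuous (R : realType) (c : R -> R -> R) (D : set R)
    (u : R -> R) (t : R) : 0 <= t ->
  measurable D -> measurable_fun [set: R] u ->
  (forall x, `|u x| <= 1 + `|x|) ->
  (forall s, 0 <= s -> lebesgue_measure.-integrable [set: R]
     (fun x => ((1 + `|x|) * c x s)%:E)) ->
  (forall s, 0 <= s -> measurable_fun [set: R] (c^~ s)) ->
  (forall s x, 0 <= s -> 0 <= c x s) ->
  (\int[lebesgue_measure]_x ((1 + `|x|) * `|c x s - c x t|)%:E)%E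
      @[s --> within `[0, +oo[ (nbhs t)] --> 0%E ->
  \int[lebesgue_measure]_(x in D) (u x * c x s)
    @[s --> within `[0, +oo[ (nbhs t)] -->
  \int[lebesgue_measure]_(x in D) (u x * c x t).
Proof.
move=> t0 mD mu u1 ic mc c0 /fine_cvg ct.
have iu s : 0 <= s ->
    lebesgue_measure.-integrable D (EFin \o (fun x => u x * c x s)).
  move=> s0; apply: (@integrableS _ _ _ _ setT) => //.
  apply: integrable_le (ic _ s0) => //; first exact: measurable_funM (mc _ s0).
  by move=> x _; rewrite normrM (ger0_norm (c0 _ _ s0)) ler_wpM2r// c0.
apply/subr_cvg0; apply: norm_cvg0.
apply: (@squeeze_cvgr _ _ _ _ (cst 0) (fun s =>
  fine (\int[lebesgue_measure]_x ((1 + `|x|) * `|c x s - c x t|)%:E)%E)) => //;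
  last exact: cvg_cst.
near=> s.
have s0 : 0 <= s.
  suff : `[0, +oo[%classic s by rewrite /= in_itv/= andbT.
  by near: s; exact: withinT.
rewrite normr_ge0/=.
have id := integrable_weighted_dist (mc s s0) (mc t t0) (c0 s ^~ s0)
  (c0 t ^~ t0) (ic s s0) (ic t t0).
have iB : lebesgue_measure.-integrable D
    (EFin \o (fun x => u x * c x s - u x * c x t)).
  exact: (@integrableB _ _ _ (@lebesgue_measure R) D mD _ _
    (iu _ s0) (iu _ t0)).
rewrite -RintegralB//; [|exact: iu|exact: iu].
rewrite (le_trans (le_normr_Rintegral _ iB))//.
apply: (@le_trans _ _
  (\int[lebesgue_measure]_(x in D) ((1 + `|x|) * `|c x s - c x t|))).
  apply: le_Rintegral => //; first exact: (integrable_norm iB).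
    exact: integrableS id.
  by move=> x _; rewrite -mulrBr normrM ler_wpM2r.
by apply: Rintegral_subset => // x; rewrite mulr_ge0// addr_ge0.
Unshelve. all: by end_near. Qed.

(** * The solution of the whole-line problem *)

Section solution.
Context (R : realType) (eps : R) (eps_gt0 : 0 < eps) (c : R -> R -> R).
Hypothesis c0_measurable : measurable_fun [set: R] (c^~ 0).
Hypothesis c0_ge0 : forall x : R, 0 <= c x 0.
Hypothesis c0_compact_support : compact (closure [set x | c x 0 != 0]).
Hypothesis c0_lt0 : forall x : R, x < 0 -> c x 0 = 0.
Hypothesis c0_integral :
  (0 < \int[lebesgue_measure]_(x in `]0%R, +oo[) ((1 + x) * c x 0)%:E < +oo)%E.
Hypothesis c_solution : whole_line_solution eps c.

Lemma initial_support : exists2 L, 0 < L &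
  forall x, c x 0 != 0 -> 0 <= x <= L.
Proof.
have [|M M0 supp] := @bounded_on_compact R R (fun x => x) _ c0_compact_support.
  by move=> p _; exact: cvg_id.
exists (1 + M); first by rewrite ltr_wpDr.
move=> x cx; apply/andP; split.
  by rewrite leNgt; apply: contra cx => x0; rewrite c0_lt0.
have := supp x (@subset_closure R [set x | c x 0 != 0] x cx).
by have := ler_norm x; lra.
Qed.

Lemma solution_regular (t : R) : 0 <= t ->
  [/\ measurable_fun [set: R] (c^~ t), forall x, 0 <= c x t &
      lebesgue_measure.-integrable [set: R]
        (fun x => ((1 + `|x|) * c x t)%:E)].
Proof.
rewrite le_eqVlt => /predU1P[<-|t0].
  split => //; apply/integrableP; split.
    apply/measurable_EFinP; apply: measurable_funM => //.
    exact: measurable_funD.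
  case/andP: c0_integral => _; apply: le_lt_trans.
  have -> : (\int[lebesgue_measure]_(x in `]0%R, +oo[) ((1 + x) * c x 0)%:E =
      \int[lebesgue_measure]_(x in `[0%R, +oo[) ((1 + x) * c x 0)%:E)%E.
    apply: integral_itv_obnd_cbnd.
    apply/measurable_EFinP/measurable_funTS/measurable_funM => //.
    exact: measurable_funD.
  rewrite [leRHS]integral_mkcond le_eqVlt; apply/orP; left; apply/eqP.
  apply: eq_integral => x _; rewrite /= ger0_norm ?mulr_ge0 ?addr_ge0// patchE.
  have [x0|x0] := leP 0 x.
    by rewrite mem_set/= ?in_itv/= ?x0// ger0_norm.
  rewrite c0_lt0// mulr0 memNset//= in_itv/= andbT.
  by apply/negP; rewrite -ltNge.
split; last 2 first.
- by move=> x; exact: (wls_ge0 c_solution).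
- exact: (wls_integrable c_solution).
apply: continuous_measurable_fun => x.
have [_ dc _] := (wls_C21 c_solution).1 x t t0.
exact: continuous_is_derive (derivable_is_derive1 dc).
Qed.

Lemma solution_continuous (t : R) : 0 < t -> continuous (c^~ t).
Proof.
move=> t0 x; have [_ dc _] := (wls_C21 c_solution).1 x t t0.
exact: continuous_is_derive (derivable_is_derive1 dc).
Qed.

Let mass t := \int[lebesgue_measure]_(x in `]0%R, +oo[) c x t.
Let moment t := \int[lebesgue_measure]_(x in `]0%R, +oo[) (x * c x t).

Let integrable_mass (t : R) : 0 <= t ->
  lebesgue_measure.-integrable `]0%R, +oo[ (EFin \o c^~ t).
Proof.
by move=> t0; have [mc c0 ic] := solution_regular t0; exact: integrable_tail.
Qed.

Let integrable_moment (t : R) : 0 <= t ->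
  lebesgue_measure.-integrable `]0%R, +oo[ (EFin \o (fun x => x * c x t)).
Proof.
move=> t0; have [mc c0 ic] := solution_regular t0.
have := integrable_moment1 mc c0 ic 0.
under eq_fun do rewrite subr0.
by apply: integrableS.
Qed.

Let mass_moment_gt0 (t : R) : 0 <= t -> 0 < mass t /\ 0 < moment t.
Proof.
move=> t0; have [mc c0 ic] := solution_regular t0.
(* The known positive integral has weight 1 + x at time 0 and weight 1 later; either one yields
   positivity of both the mass and the first moment. *)
have [u [mu u0 uc]] : exists u : R -> R, [/\ measurable_fun [set: R] u,
    forall x, `]0%R, +oo[%classic x -> 0 <= u x &
    (0 < \int[lebesgue_measure]_(x in `]0%R, +oo[) (u x * c x t)%:E)%E].
  move: t0; rewrite le_eqVlt => /predU1P[<-|t0].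
    exists (fun x => 1 + x); split.
    - exact: measurable_funD.
    - by move=> x; rewrite /= in_itv/= andbT => x0; rewrite addr_ge0// ltW.
    - by case/andP: c0_integral.
  exists (fun=> 1); split => //.
  under eq_integral do rewrite mul1r.
  exact: (wls_mass_gt0 c_solution).
have h (v : R -> R) : measurable_fun [set: R] v ->
    (forall x, `]0%R, +oo[%classic x -> 0 < v x) ->
    (0 < \int[lebesgue_measure]_(x in `]0%R, +oo[) (v x * c x t)%:E)%E.
  by move=> mv v0; apply: (weighted_integral_gt0 _ mc c0 mu mv u0 v0 uc).
split; rewrite /mass /moment /Rintegral fine_gt0//.
  rewrite ltey_eq (integrable_fin_num _ (integrable_mass t0))// andbT.
  have h1 := h (fun=> 1) (@measurable_cst _ _ _ _ _ _) (fun _ _ => ltr01).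
  rewrite (_ : integral _ _ _ =
      \int[lebesgue_measure]_(x in `]0%R, +oo[) (1 * c x t)%:E)%E//.
  by apply: eq_integral => x _; rewrite mul1r.
rewrite ltey_eq (integrable_fin_num _ (integrable_moment t0))// andbT.
by apply: h => // x; rewrite /= in_itv/= andbT.
Qed.

Let continuous_weighted (D : set R) (u : R -> R) :
  measurable D -> measurable_fun [set: R] u -> (forall x, `|u x| <= 1 + `|x|) ->
  continuous (fun s : R =>
    \int[lebesgue_measure]_(x in D) (u x * c x (Num.max s 0))).
Proof.
move=> mD mu u1.
apply: (@continuous_max0 R
  (fun s => \int[lebesgue_measure]_(x in D) (u x * c x s))).
move=> t t0; apply: weighted_integral_continuous => //.
- by move=> s s0; have [] := solution_regular s0.
- by move=> s s0; have [] := solution_regular s0.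
- by move=> s x s0; have [] := solution_regular s0.
- exact: (wls_continuous c_solution).
Qed.

Let l (s : R) := (Lambda c (Num.max s 0))^-1.

Let Lambda_gt0 (t : R) : 0 <= t -> 0 < Lambda c t.
Proof. by move=> /mass_moment_gt0[m0 m1]; exact: divr_gt0. Qed.

Let max0_ge0 (s : R) : 0 <= Num.max s 0. Proof. by rewrite le_max lexx orbT. Qed.

Let l_gt0 (s : R) : 0 < l s.
Proof. by rewrite invr_gt0 Lambda_gt0. Qed.

Let lE (s : R) : 0 <= s -> l s = (Lambda c s)^-1.
Proof. by move=> s0; rewrite /l max_l. Qed.

Let continuous_l : continuous l.
Proof.
move=> s; have [n0 m0] := mass_moment_gt0 (max0_ge0 s).
have cn : {for s, continuous (fun s : R => mass (Num.max s 0))}.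
  have -> : (fun s : R => mass (Num.max s 0)) = (fun s : R =>
      \int[lebesgue_measure]_(x in `]0%R, +oo[) (1 * c x (Num.max s 0))).
    by apply/funext => r; apply: eq_Rintegral => x _; rewrite mul1r.
  apply: (@continuous_weighted _ (fun=> 1)) => // x.
  by rewrite normr1 lerDl.
have cm : {for s, continuous (fun s : R => moment (Num.max s 0))}.
  apply: (@continuous_weighted _ (fun x => x)) => // x.
  by rewrite lerDr.
have m0' : moment (Num.max s 0) != 0 by rewrite gt_eqF.
have n0' : mass (Num.max s 0) != 0 by rewrite gt_eqF.
have mn0 : moment (Num.max s 0) / mass (Num.max s 0) != 0.
  by rewrite mulf_neq0// invr_neq0.
have cl : {for s, continuous
    (fun s : R => (moment (Num.max s 0) / mass (Num.max s 0))^-1)}.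
  apply: (@continuous_invf R R s
    (fun s : R => moment (Num.max s 0) / mass (Num.max s 0)) mn0).
  apply: (@continuous_mulf R R s (fun s : R => moment (Num.max s 0))
    (fun s : R => (mass (Num.max s 0))^-1) cm).
  exact: (@continuous_invf R R s (fun s : R => mass (Num.max s 0)) n0' cn).
exact: cl.
Qed.

Let moment_bound (T : R) : exists KN, forall s, 0 <= s -> s <= T ->
  \int[lebesgue_measure]_x ((1 + `|x|) * c x s) <= KN.
Proof.
have [||M M0 HM] := @bounded_on_compact R R (fun s =>
  \int[lebesgue_measure]_x ((1 + `|x|) * c x (Num.max s 0))) `[0, T].
- exact: segment_compact.
- move=> s _; apply: continuous_weighted => //.
    exact: measurable_funD.
  by move=> x; rewrite ger0_norm// addr_ge0.
- exists M => s s0 sT; have := HM s; rewrite /= in_itv/= s0 sT => /(_ isT).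
  by rewrite max_l//; apply: le_trans; exact: ler_norm.
Qed.

Let l_bound (T : R) : exists KL, forall s, 0 <= s -> s <= T -> l s <= KL.
Proof.
have [||M M0 HM] := @bounded_on_compact R R l `[0, T].
- exact: segment_compact.
- by move=> s _; exact: continuous_l.
- exists M => s s0 sT; have := HM s; rewrite /= in_itv/= s0 sT => /(_ isT).
  by apply: le_trans; exact: ler_norm.
Qed.

Lemma solution_flow_exists : exists m a b, is_flow l m a b.
Proof. exact: flow_exists continuous_l l_gt0. Qed.

Context (m a b : R -> R).
Hypothesis flow : is_flow l m a b.

Let m_gt0 (s : R) : 0 < m s. Proof. exact: (flow_m_gt0 flow). Qed.

(** Duality with the initial variance chosen so that (s / m t)^2 is left at time [t], which is
    standard deviation [s] in the variable x. The left side is then c(., t) smoothed at scale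
    [s]. *)
Let gaussian_representation (t s z : R) : 0 < t -> 0 < s ->
  m t / normal_peak 1 *
    \int[lebesgue_measure]_y (c y t * normal_pdf (m t * (z - a t)) s y) =
  \int[lebesgue_measure]_y
    (c y 0 * heat_kernel (eps * b t + (s / m t) ^+ 2) (z - y)).
Proof.
move=> t0 s0; pose beta := eps * b t + (s / m t) ^+ 2.
have mt := m_gt0 t.
have t1 : - 1 < t by rewrite (lt_trans _ t0)// ltrN10.
(* Duality holds strictly before [T]; as s > 0 leaves some variance at time [t], continuity of [b]
   gives room for such a [T]. *)
have [T tT bT] : exists2 T, t < T & eps * b T < beta.
  have [_ _ cb] := flow_continuous flow t1.
  have cb' : eps * b r @[r --> t] --> eps * b t.
    by apply: cvgM => //; exact: cvg_cst.
  have bt : eps * b t < beta by rewrite ltrDl exprn_gt0// divr_gt0.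
  near t^'+ => T; exists T; near: T; first exact: nbhs_right_gt.
  exact: (cvgr_lt _ (cvg_at_right_filter cb') _ bt).
have [KL lKL] := l_bound T; have [KN NKN] := moment_bound T.
rewrite -[in RHS]/beta -(@duality R eps c eps_gt0 (wls_C21 c_solution)
  solution_regular l m a b _ continuous_l l_gt0 flow _ T beta z KL KN
  (lt_trans t0 tT) bT lKL NKN t t0 tT); last 2 first.
- by move=> x r r0; rewrite (lE (ltW r0)); exact: (wls_equation c_solution).
- exact: (wls_continuous c_solution).
rewrite -RintegralZl//; last first.
  have [mc c0 ic] := solution_regular (ltW t0).
  by apply: integrable_mul_normal => //; exact: integrable_moment0.
apply: eq_Rintegral => y _; rewrite mulrCA; congr (_ * _).
rewrite -heat_kernel_scaled// /beta addrAC subrr add0r; congr heat_kernel.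
by field; rewrite gt_eqF.
Unshelve. all: by end_near. Qed.

Let b_gt0 (t : R) : 0 < t -> 0 < b t.
Proof.
move=> t0.
(* The derivative of [b] is given at positive times only, hence the interval [t / 2, t]. *)
have t2 : 0 < t / 2 by rewrite divr_gt0.
have [||x /andP[tx xt] bE] :=
  @MVT_is_derive R b (fun s => (m s ^+ 2)^-1) (t / 2) t.
- lra.
- move=> x /andP[tx _]; have x0 : 0 < x by exact: lt_le_trans tx.
  by have [] := flow_is_derive flow x0.
have : b 0 <= b (t / 2) by rewrite (flow_b_le flow) ?ltrN10// ltW.
rewrite (flow_b0 flow) => b2.
have : 0 < b t - b (t / 2).
  by rewrite bE mulr_gt0 ?invr_gt0 ?exprn_gt0//; lra.
lra.
Qed.

Let z_ t x := x / m t + a t.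

(** For the smoothed solution this is [heat_kernel_monotone] integrated over the initial data;
    letting s -> 0 transfers it to c(., t) by the approximate identity. *)
Lemma solution_monotone (t y0 x1 x2 : R) : 0 < t ->
  (forall y, c y 0 != 0 -> 0 <= (y - y0) * (x2 - x1)) ->
  expR ((z_ t x1 - y0) ^+ 2 / (2 * (eps * b t))) * c x1 t <=
  expR ((z_ t x2 - y0) ^+ 2 / (2 * (eps * b t))) * c x2 t.
Proof.
move=> t0 supp; have mt := m_gt0 t; have bt := b_gt0 t0.
have ebt : 0 < eps * b t by rewrite mulr_gt0.
pose beta s := eps * b t + (s / m t) ^+ 2.
pose N x s := \int[lebesgue_measure]_y (c y t * normal_pdf x s y).
have [mc c0 ic] := solution_regular (ltW t0).
have [mc0 c00 ic0] := solution_regular (lexx 0).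
have NE x s : 0 < s -> m t / normal_peak 1 * N x s =
    \int[lebesgue_measure]_y (c y 0 * heat_kernel (beta s) (z_ t x - y)).
  move=> s0; rewrite -(gaussian_representation (z_ t x) t0 s0).
  by rewrite /z_ addrK [m t * (_ / _)]mulrC divfK ?gt_eqF.
have beta0 s : 0 < beta s by rewrite ltr_pwDl// sqr_ge0.
have ik x s : lebesgue_measure.-integrable [set: R]
    (EFin \o (fun y => c y 0 * heat_kernel (beta s) (z_ t x - y))).
  pose k := expR (- (ln (beta s) / 2)).
  have ikc : lebesgue_measure.-integrable [set: R]
      (EFin \o (fun y => k * c y 0)).
    by apply: integrable_scale => //; exact: integrable_moment0.
  apply: integrable_le ikc => //.
    apply: measurable_funM => //; apply: continuous_measurable_fun => y.
    suff : {for y, continuous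
      (fun y => heat_kernel (beta s) (z_ t x - y))} by [].
    rewrite /heat_kernel; continuous_step.
    exact: (continuous_oppf (@continuous_idf R y)).
  move=> y _; rewrite ger0_norm ?mulr_ge0 ?expR_ge0// mulrC ler_wpM2r//.
  rewrite ler_expR gerDr oppr_le0 divr_ge0 ?sqr_ge0// mulr_ge0// ltW//.
have le_s s : 0 < s ->
    expR ((z_ t x1 - y0) ^+ 2 / (2 * beta s)) * N x1 s <=
    expR ((z_ t x2 - y0) ^+ 2 / (2 * beta s)) * N x2 s.
  move=> s0; have k0 : 0 < m t / normal_peak 1.
    by rewrite divr_gt0// normal_peak_gt0// oner_neq0.
  rewrite -(ler_pM2l k0) mulrCA [leRHS]mulrCA (NE x1 s s0) (NE x2 s s0).
  rewrite -[leLHS]RintegralZl; [|by []|exact: ik].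
  rewrite -[leRHS]RintegralZl; [|by []|exact: ik].
  have iZ x g : lebesgue_measure.-integrable [set: R]
      (EFin \o (fun y => g * (c y 0 * heat_kernel (beta s) (z_ t x - y)))).
    exact: integrable_scale.
  apply: le_Rintegral => // y _.
  have [->|cy] := eqVneq (c y 0) 0; first by rewrite !mul0r !mulr0.
  rewrite mulrCA [leRHS]mulrCA ler_wpM2l//; apply: heat_kernel_monotone => //.
  have -> : z_ t x2 - z_ t x1 = (x2 - x1) / m t.
    by rewrite /z_; field; rewrite gt_eqF.
  by rewrite mulrA divr_ge0 ?supp// ltW.
have lim x : expR ((z_ t x - y0) ^+ 2 / (2 * beta s)) * N x s @[s --> 0^'+] -->
    expR ((z_ t x - y0) ^+ 2 / (2 * (eps * b t))) * c x t.
  apply: cvgM; last first.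
    apply: normal_approximation_cvg => //; last exact: solution_continuous.
    exact: integrable_moment0.
  apply: cvg_at_right_filter.
  have b00 : beta 0 = eps * b t by rewrite /beta mul0r expr0n addr0.
  have : {for 0, continuous
      (fun s => expR ((z_ t x - y0) ^+ 2 / (2 * beta s)))}.
    rewrite /beta; continuous_step.
    by rewrite -/(beta 0) gt_eqF// mulr_gt0.
  by rewrite /prop_for /continuous_at b00.
apply: (ler_cvg_to (lim x1) (lim x2)); near=> s.
by apply: le_s; near: s; exact: nbhs_right_gt.
Unshelve. all: by end_near. Qed.

(** The function of [solution_monotone] has derivative [E x * (dc + r)], so monotonicity fixes the
    sign of dc + r. It is used with [y0 = 0] and with [y0 = L]. *)
Lemma solution_log_derivative (t y0 x : R) : 0 < t ->
  let dc := (c^~ t)^`()%classic x in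
  let r := (x + m t * (a t - y0)) / (m t ^+ 2 * (eps * b t)) * c x t in
  ((forall y, c y 0 != 0 -> y0 <= y) -> - dc <= r) /\
  ((forall y, c y 0 != 0 -> y <= y0) -> r <= - dc).
Proof.
move=> t0 dc r; have mt := m_gt0 t; have bt := b_gt0 t0.
have ebt : 0 < eps * b t by rewrite mulr_gt0.
pose E x := expR ((z_ t x - y0) ^+ 2 / (2 * (eps * b t))).
have dcE : is_derive x 1 (c^~ t) dc.
  have [_ dc' _] := (wls_C21 c_solution).1 x t t0.
  exact: derivable_is_derive1 dc'.
have V2 : 2 * (eps * b t) != 0 by rewrite gt_eqF// mulr_gt0.
have dE : is_derive x 1 (fun x => E x * c x t) (E x * (dc + r)).
  rewrite /E /z_; is_derive_rules; [exact: dcE|].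
  by rewrite /r /z_ /=; field; rewrite !gt_eqF.
have E0 : 0 < E x by exact: expR_gt0.
split => supp.
  rewrite lerNl -subr_ge0 opprK -(pmulr_rge0 _ E0).
  apply: (is_derive_ge0_of_monotone dE) => y.
  have [xy|yx] := leP x y.
    rewrite mulr_ge0 ?subr_ge0//; apply: solution_monotone => // u cu.
    by rewrite mulr_ge0 ?subr_ge0// supp.
  rewrite -mulrNN mulr_ge0 ?oppr_ge0 ?subr_le0 ?(ltW yx)//.
  apply: solution_monotone => // u cu.
  by rewrite mulr_ge0 ?subr_ge0 ?supp// ltW.
rewrite -subr_ge0 -opprD oppr_ge0 -(pmulr_rle0 _ E0) -oppr_ge0.
apply: (is_derive_ge0_of_monotone (is_derive_oppf dE)) => y.
rewrite -opprD mulrN -mulNr opprB.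
have [xy|yx] := leP x y.
  rewrite -mulrNN mulr_ge0 ?oppr_ge0 ?subr_le0//.
  apply: solution_monotone => // u cu.
  by rewrite -mulrNN mulr_ge0// oppr_ge0 subr_le0 ?supp.
rewrite mulr_ge0 ?subr_ge0 ?(ltW yx)//.
apply: solution_monotone => // u cu.
by rewrite -mulrNN mulr_ge0// oppr_ge0 subr_le0 ?supp// ltW.
Qed.

(** * Positivity of the tails, growth of [a] and convergence of beta *)

Let moment_integrable (t : R) : 0 < t -> lebesgue_measure.-integrable [set: R]
  (fun x => ((1 + `|x|) * c x t)%:E).
Proof. by move=> t0; have [] := solution_regular (ltW t0). Qed.

Let c_ge0 (t : R) : 0 < t -> forall x, 0 <= c x t.
Proof. by move=> t0; have [] := solution_regular (ltW t0). Qed.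

Let is_derive_c (t x : R) : 0 < t ->
  is_derive x 1 (c^~ t) ((c^~ t)^`()%classic x).
Proof.
move=> t0; have [_ dc _] := (wls_C21 c_solution).1 x t t0.
exact: derivable_is_derive1 dc.
Qed.

Let initial_support_ge0 (y : R) : c y 0 != 0 -> 0 <= y.
Proof. by move=> cy; have [L _ /(_ _ cy)/andP[]] := initial_support. Qed.

(** Positive mass gives a point where c > 0. By [solution_monotone] with [y0 = 0], c times a
    positive factor is nondecreasing, so c stays positive from there on and no tail vanishes. *)
Lemma solution_w_gt0 (t x : R) : 0 < t -> 0 < w_of (c^~ t) x.
Proof.
move=> t0; have c0 := c_ge0 t0.
have [x1 _ cx1] : exists2 x1, 0 < x1 & 0 < c x1 t.
  apply: contrapT => H; have [m0 _] := mass_moment_gt0 (ltW t0).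
  move: m0; rewrite /mass /Rintegral integral0_eq ?ltxx// => y /=.
  rewrite in_itv/= andbT => y0; congr EFin; apply/eqP.
  rewrite eq_le c0 andbT leNgt; apply/negP => cy.
  by apply: H; exists y.
have c_gt0 y : x1 <= y -> 0 < c y t.
  move=> xy; have := @solution_monotone t 0 x1 y t0.
  have supp u : c u 0 != 0 -> 0 <= (u - 0) * (y - x1).
    by move=> cu; rewrite subr0 mulr_ge0 ?subr_ge0// initial_support_ge0.
  move=> /(_ supp) h.
  have : 0 < expR ((z_ t x1 - 0) ^+ 2 / (2 * (eps * b t))) * c x1 t.
    by rewrite mulr_gt0// expR_gt0.
  by move=> /lt_le_trans/(_ h); rewrite pmulr_rgt0 ?expR_gt0.
have dw (y : R) : is_derive y 1 (w_of (c^~ t)) (- c y t).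
  have [mc _ _] := solution_regular (ltW t0).
  apply: (is_derive_w mc c0); first exact: moment_integrable.
  exact: solution_continuous.
pose y := Num.max x x1.
have y1 : y < y + 1 by rewrite ltrDl.
have [z /andP[yz _] wE] :=
  @MVT_is_derive R (w_of (c^~ t)) (fun y => - c y t) y (y + 1) y1
    (fun z _ => dw z).
have xy : x <= y by rewrite le_max lexx.
have x1y : x1 <= y by rewrite le_max lexx orbT.
have wxy : w_of (c^~ t) y <= w_of (c^~ t) x.
  apply: (@is_derive_le0_le R _ (fun y => - c y t)) => // u _.
  by rewrite oppr_le0.
have := w_of_ge0 c0 (y + 1).
have := c_gt0 _ (le_trans x1y (ltW yz)).
have e1 : y + 1 - y = 1 by rewrite addrAC subrr add0r.
rewrite e1 mulr1 in wE; move: wE.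
lra.
Qed.

Lemma Lambda_h_div_w (t : R) : 0 < t ->
  Lambda c t = h_of (c^~ t) 0 / w_of (c^~ t) 0.
Proof.
move=> t0; have [mc c0 ic] := solution_regular (ltW t0).
rewrite (h_ofE mc c0 ic) /Lambda /w_of; congr (_ / _).
by apply: eq_Rintegral => x _; rewrite subr0.
Qed.

Lemma solution_h0_gt0 (t : R) : 0 < t -> 0 < h_of (c^~ t) 0.
Proof.
move=> t0; have [mc c0 ic] := solution_regular (ltW t0).
rewrite (h_ofE mc c0 ic) (_ : Rintegral _ _ _ = moment t).
  by have [] := mass_moment_gt0 (ltW t0).
by apply: eq_Rintegral => x _; rewrite subr0.
Qed.

Let df_le (t x : R) : 0 < t ->
  - (c^~ t)^`()%classic x <=
  (x + m t * a t) / (m t ^+ 2 * (eps * b t)) * c x t.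
Proof.
move=> t0; have [/(_ initial_support_ge0) + _] := solution_log_derivative 0 x t0.
by rewrite subr0.
Qed.

(** 1 / [Lambda] is w(0) / h(0), so [w_le_h_at0] applies with [t] taken as m sqrt(eps b). It needs
    only the bound for [y0 = 0], so it holds at all positive times. *)
Let l_le (t : R) : 0 < t ->
  l t <= (a t / (eps * b t) + 3 / Num.sqrt (eps * b t)) / m t.
Proof.
move=> t0; have mt := m_gt0 t; have [mc c0 ic] := solution_regular (ltW t0).
pose s := Num.sqrt (eps * b t).
have v0 : 0 < eps * b t by rewrite mulr_gt0// b_gt0.
have s0 : 0 < s by rewrite sqrtr_gt0.
have sE : eps * b t = s ^+ 2 by rewrite sqr_sqrtr// ltW.
have at0 : 0 <= a t by rewrite -(flow_a0 flow) (flow_a_le flow)// ltW.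
have := @w_le_h_at0 R (c^~ t) (c^~ t)^`()%classic (solution_continuous t0) c0 ic
  (m t ^+ 2 * (eps * b t)) (m t * a t) _ (fun x _ => is_derive_c x t0)
  (fun x _ => df_le x t0) (m t * s) _ _ _.
rewrite mulr_gt0 ?exprn_gt0// => /(_ isT).
rewrite mulr_ge0 ?(ltW mt)// => /(_ isT).
rewrite mulr_gt0// => /(_ isT); rewrite {1}sE -exprMn => /(_ erefl) wh.
rewrite (lE (ltW t0)) (Lambda_h_div_w t0) invf_div -/s.
have h0 := solution_h0_gt0 t0.
rewrite ler_pdivrMr// -(ler_pM2l (_ : 0 < m t ^+ 2 * (eps * b t))); last first.
  by rewrite mulr_gt0// exprn_gt0.
rewrite (le_trans wh)// le_eqVlt; apply/orP; left; apply/eqP.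
by rewrite sE; field; rewrite !gt_eqF.
Qed.

(* While [a] stays bounded, [d ln m <= C da], so that [m] is bounded and
   [a' = 1 / m] is bounded below. *)
Lemma flow_a_unbounded (A : R) :
  exists2 t0, 0 < t0 & forall t, t0 <= t -> A <= a t.
Proof.
suff [t0 t00 At0] : exists2 t0, 0 < t0 & A <= a t0.
  exists t0 => // t t0t; rewrite (le_trans At0)//.
  by apply: (flow_a_le flow) => //; exact: ltW.
apply: contrapT => H.
have a_lt t : 0 < t -> a t < A.
  by move=> t0; rewrite ltNge; apply/negP => At; apply: H; exists t.
(* Everything below starts at time 1: [b] vanishes at 0, where the bound [l_le] degenerates. *)
have v1 : 0 < eps * b 1 by rewrite mulr_gt0// b_gt0.
pose s1 := Num.sqrt (eps * b 1).
have s10 : 0 < s1 by rewrite sqrtr_gt0.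
have a1 : 0 <= a 1 by rewrite -(flow_a0 flow) (flow_a_le flow).
have A0 : 0 < A by rewrite (le_lt_trans a1)// a_lt.
pose C := A / (eps * b 1) + 3 / s1.
have C0 : 0 < C by rewrite addr_gt0// divr_gt0.
have l_leC t : 1 <= t -> l t <= C / m t.
  move=> t1; have t0 : 0 < t by exact: lt_le_trans t1.
  have bt : eps * b 1 <= eps * b t.
    by rewrite ler_pM2l// (flow_b_le flow)// (lt_trans (ltrN10 _) ltr01).
  have v0 : 0 < eps * b t by rewrite mulr_gt0// b_gt0.
  rewrite (le_trans (l_le t0))// ler_pM2r ?invr_gt0// lerD//.
    apply: ler_pM.
    - by rewrite -(flow_a0 flow) (flow_a_le flow)// ltW.
    - by rewrite invr_ge0 ltW.
    - by rewrite ltW// a_lt.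
    - by rewrite lef_pV2.
  by rewrite ler_pM2l// lef_pV2 ?posrE ?sqrtr_gt0// ler_wsqrtr.
pose M := expR (C * A + ln (m 1)).
have m_le t : 1 <= t -> m t <= M.
  move=> t1; have t0 : 0 < t by exact: lt_le_trans t1.
  rewrite -[m t]lnK ?posrE// ler_expR.
  have : ln (m t) - C * a t <= ln (m 1) - C * a 1.
    apply: (@is_derive_le0_le R (fun s => ln (m s) - C * a s)
      (fun s => l s - C / m s)) => // s /andP[s1' st].
      have s0 : 0 < s by exact: lt_le_trans s1'.
      have [dm da _] := flow_is_derive flow s0.
      is_derive_rules; [exact: m_gt0|exact: dm|exact: da|].
      by rewrite /=; field; rewrite gt_eqF.
    by rewrite subr_le0 l_leC.
  have : C * a t <= C * A by rewrite ler_pM2l// ltW// a_lt.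
  have : 0 <= C * a 1 by rewrite mulr_ge0// ltW.
  lra.
have M0 : 0 < M by exact: expR_gt0.
(* With a' >= 1 / M on [1, t], [a] gains at least A there, against a t < A. *)
pose t := 1 + M * A.
have t1 : 1 <= t by rewrite lerDl mulr_ge0// ltW.
have : a 1 - 1 / M <= a t - t / M.
  apply: (@is_derive_ge0_le R (fun s => a s - s / M)
    (fun s => (m s)^-1 - M^-1)) => //.
    move=> s /andP[s1' st]; have s0 : 0 < s by exact: lt_le_trans s1'.
    have [_ da _] := flow_is_derive flow s0.
    by is_derive_rules; [exact: da|]; rewrite /= mul1r mulr0 addr0.
  move=> s /andP[s1' st]; rewrite subr_ge0 lef_pV2 ?posrE ?m_gt0//.
  exact: m_le.
have -> : t / M = 1 / M + A by rewrite /t; field; rewrite gt_eqF.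
have := a_lt t (lt_le_trans ltr01 t1).
lra.
Qed.

Lemma beta_eventually_near1 (d : R) : 0 < d ->
  exists2 t0, 0 < t0 & forall t, t0 <= t ->
    forall x, 0 < x -> `|beta_of (c^~ t) x - 1| <= d.
Proof.
move=> d0; have [L L0 supp] := initial_support.
(* The lower bound on beta needs (A + eps)^2 - (A - L) A <= N (A + eps), with A the value of [a];
   this fixes N. The upper bound only needs eps + L. *)
pose N := 2 * eps + L.
have N0 : 0 < N by rewrite addr_gt0// mulr_gt0.
have [t0 t00 Ht] := flow_a_unbounded (L + N / d).
exists t0 => // t t0t x x0; have t_gt0 : 0 < t by exact: lt_le_trans t0t.
have aL : N / d <= a t - L by rewrite lerBrDl Ht.
have aL0 : 0 < a t - L by rewrite (lt_le_trans _ aL)// divr_gt0.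
apply: (@le_trans _ _ (N / (a t - L))); last first.
  by rewrite ler_pdivrMr// mulrC -ler_pdivrMr.
have mt := m_gt0 t; have bt := b_gt0 t_gt0.
have [mc c0 ic] := solution_regular (ltW t_gt0).
have v0 : 0 < eps * b t by rewrite mulr_gt0.
have mv0 : 0 < m t ^+ 2 * (eps * b t) by rewrite mulr_gt0// exprn_gt0.
have A'0 : 0 < m t * (a t - L) by rewrite mulr_gt0.
have A'A : m t * (a t - L) <= m t * a t by rewrite ler_pM2l// gerBl ltW.
have df_ge (y : R) : 0 <= y ->
    (y + m t * (a t - L)) / (m t ^+ 2 * (eps * b t)) * c y t <=
    - (c^~ t)^`()%classic y.
  move=> y0; have [_] := solution_log_derivative L y t_gt0; apply.
  by move=> u /supp /andP[].
have := @beta_of_bounds R (c^~ t) (c^~ t)^`()%classic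
  (solution_continuous t_gt0) c0 ic
  (fun x => solution_w_gt0 x t_gt0) _ _ mv0 (fun x _ => is_derive_c x t_gt0)
  (fun x _ => df_le x t_gt0) _ A'0 A'A df_ge x x0.
have ba : b t <= a t by rewrite (flow_b_le_a flow)// ltW.
(* From here on [m] cancels in every ratio; b <= a then bounds eps b / a^2 by eps / a. *)
move: (a t) (b t) (m t) bt ba aL0 mt v0 {mv0 A'0 A'A df_ge aL}.
move=> A B M B0 BA AL M0 v0.
have A0 : 0 < A by rewrite (lt_trans _ (_ : L < A))// -subr_gt0.
set beta := beta_of _ _.
have -> : M ^+ 2 * (eps * B) / (M * A) ^+ 2 = eps * B / A ^+ 2.
  by field; rewrite !gt_eqF.
have -> : M * A / (M * (A - L)) = A / (A - L).
  by field; rewrite !gt_eqF.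
have -> : M * A + M ^+ 2 * (eps * B) / (M * A) = M * (A + eps * B / A).
  by field; rewrite !gt_eqF.
rewrite -mulf_div divff ?gt_eqF// mul1r.
have e1 : eps * B / A ^+ 2 <= eps / A.
  rewrite ler_pdivrMr ?exprn_gt0// mulrAC ler_pdivlMr//.
  by rewrite expr2 !mulrA ler_pM2r// ler_pM2l.
have e2 : eps * B / A <= eps by rewrite ler_pdivrMr// ler_pM2l.
have e3 : 0 < eps * B / A ^+ 2 by rewrite divr_gt0// exprn_gt0.
have e4 : 0 < eps * B / A by rewrite divr_gt0.
have e5 : 0 < eps / A by rewrite divr_gt0.
move=> /andP[lo hi]; rewrite ler_norml; apply/andP; split.
  have : (A - L) / (A + eps) / (1 + eps / A) <= beta.
    apply: le_trans lo; rewrite ler_pM//.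
    - by rewrite divr_ge0 ?(ltW AL)// addr_ge0// ltW.
    - by rewrite invr_ge0 addr_ge0// ltW.
    - rewrite ler_pM2l// lef_pV2 ?posrE ?addr_gt0//.
      by rewrite lerD2l.
    - by rewrite lef_pV2 ?posrE ?addr_gt0// lerD2l.
  rewrite lerBrDl; apply: le_trans.
  have Ae : 0 < A + eps by rewrite addr_gt0.
  have -> : (A - L) / (A + eps) / (1 + eps / A) = (A - L) * A / (A + eps) ^+ 2.
    by field; rewrite !gt_eqF.
  rewrite ler_pdivlMr ?exprn_gt0//.
  have Nle : N * (A + eps) <= N / (A - L) * (A + eps) ^+ 2.
    rewrite mulrAC ler_pdivlMr// -mulrA ler_pM2l// expr2 ler_pM2l// lerD2l.
    by rewrite (le_trans _ (ltW eps_gt0))// oppr_le0 ltW.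
  have := mulr_gt0 eps_gt0 eps_gt0; have := mulr_gt0 eps_gt0 L0.
  move: Nle; rewrite /N !expr2; lra.
rewrite lerBlDr (le_trans hi)//.
apply: (@le_trans _ _ ((1 + eps / A) * (A / (A - L)))).
  by rewrite ler_pM2r ?divr_gt0// lerD2l.
have -> : (1 + eps / A) * (A / (A - L)) = (A + eps) / (A - L).
  by field; rewrite !gt_eqF.
rewrite ler_pdivrMr// mulrDl mul1r divfK ?gt_eqF//.
rewrite /N; have := eps_gt0; lra.
Qed.

End solution.

(** * Convergence in distribution *)

Section density.
Context d (T : measurableType d) (R : realType) (P : probability T R).
Context (X : {RV P >-> R}) (c : R -> R).
Hypotheses (mc : measurable_fun [set: R] c) (cc : continuous c).
Hypothesis c_ge0 : forall x, 0 <= c x.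
Hypothesis c_moment : lebesgue_measure.-integrable [set: R]
  (fun x => ((1 + `|x|) * c x)%:E).
Hypothesis X_pdf : has_pdf_proportional X c.

Let w := w_of c.

(** Total probability 1 forces the proportionality constant to be 1 / w(0). *)
Lemma density_ccdf : 0 < w 0 /\
  forall r, 0 <= r -> ccdf X r = (w r / w 0)%:E.
Proof.
have [k k0 XE] := X_pdf.
have kw r : 0 <= r ->
    (\int[lebesgue_measure]_(x in `]r, +oo[ `&` `]0%R, +oo[) (k * c x)%:E =
     (k * w r)%:E)%E.
  move=> r0; have -> : (`]r, +oo[ `&` `]0, +oo[)%classic = `]r, +oo[%classic.
    apply/setIidPl => x; rewrite /= !in_itv/= !andbT.
    exact: le_lt_trans.
  rewrite /w /w_of -RintegralZl//; last exact: integrable_tail.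
  rewrite /Rintegral fineK//; apply: integrable_fin_num => //.
  by apply: integrable_scale => //; exact: integrable_tail.
have kw1 : k * w 0 = 1.
  have := XE setT measurableT; rewrite setTI.
  rewrite (_ : (`]0%R, +oo[)%classic = `]0%R, +oo[ `&` `]0%R, +oo[).
    by rewrite kw// probability_setT => /esym [].
  by rewrite setIid.
have w0 : 0 < w 0 by rewrite -(pmulr_rgt0 _ k0) kw1.
split=> // r r0; rewrite /ccdf XE// kw//; congr EFin.
by rewrite -[k](mulfK (lt0r_neq0 w0)) kw1 mul1r mulrC.
Qed.

Lemma density_cdf_le0 (r : R) : r <= 0 -> cdf X r = 0%E.
Proof.
move=> r0; have [k k0 XE] := X_pdf.
rewrite /cdf XE// (_ : _ `&` _ = set0) ?integral_set0//.
apply/seteqP; split => // x /=; rewrite !in_itv/= andbT => -[xr x0].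
by have := lt_le_trans x0 (le_trans xr r0); rewrite ltxx.
Qed.

Lemma density_cdf (r : R) : 0 <= r -> cdf X r = (1 - w r / w 0)%:E.
Proof. by move=> r0; rewrite cdf_1_ccdf density_ccdf.2// EFinB. Qed.

Lemma density_expectation : ('E_P[X] = (h_of c 0 / w 0)%:E)%E.
Proof.
have [w0 ccdfE] := density_ccdf.
(* The layer-cake formula asks for a variable that is non-negative everywhere, while [X] is so only
   almost surely; its positive part has the same expectation. *)
transitivity ('E_P[X^\+%R])%E.
  rewrite !expectation_def; apply: ae_eq_integral => //.
  - by apply/measurable_EFinP.
  - by apply/measurable_EFinP.
  exists (X @^-1` `]-oo, 0[); split.
  - by rewrite -[X in measurable X]setTI; apply: measurable_funPT.
  - have [k k0 XE] := X_pdf.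
    change (distribution P X `]-oo, 0[ = 0%E).
    rewrite XE// (_ : _ `&` _ = set0) ?integral_set0//.
    apply/seteqP; split => // x /=; rewrite !in_itv/= andbT => -[x0 x1].
    by have := lt_trans x0 x1; rewrite ltxx.
  - move=> x /= H; rewrite in_itv/= ltNge; apply/negP => x0; apply: H => _.
    by rewrite /funrpos max_l.
rewrite ge0_expectation_ccdf; last by move=> x; exact: funrpos_ge0.
transitivity (\int[lebesgue_measure]_(r in `[0%R, +oo[) ((w 0)^-1 * w r)%:E)%E.
  apply: eq_integral => r; rewrite inE/= in_itv/= andbT => r0.
  rewrite mulrC -ccdfE// /ccdf /distribution /pushforward; congr (P _).
  apply/seteqP; split => x /=; rewrite !in_itv/= !andbT /funrpos lt_max.
    by move=> /orP[//|r0']; move: r0; rewrite leNgt r0'.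
  by move=> ->.
have iw := integrable_w mc c_ge0 c_moment cc 0.
rewrite -integral_itv_obnd_cbnd; last first.
  apply/measurable_EFinP/measurable_funTS/measurable_funM => //.
  exact: continuous_measurable_fun (continuous_w mc c_ge0 c_moment cc).
rewrite mulrC /h_of -RintegralZl// /Rintegral fineK//.
apply: integrable_fin_num => //.
exact: integrable_scale.
Qed.

Lemma normalized_cdf (x : R) : 0 < h_of c 0 ->
  cdf (normalized X) x = cdf X (x * (h_of c 0 / w 0)).
Proof.
move=> h0; have [w0 _] := density_ccdf.
rewrite /cdf /distribution /pushforward/=; congr (P _).
apply/seteqP; split => y /=; rewrite !in_itv/= density_expectation/=.
  by rewrite ler_pdivrMr// divr_gt0.
by rewrite ler_pdivrMr// divr_gt0.
Qed.

End density.

Lemma exponential_cdf d (T : measurableType d) (R : realType)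
    (P : probability T R) (Y : {RV P >-> R}) (x : R) : is_exponential1 Y ->
  cdf Y x = (if x <= 0 then 0 else 1 - expR (- x))%:E.
Proof.
move=> YE; rewrite /cdf YE//.
have -> : exponential_prob 1 `]-oo, x] =
    exponential_prob 1 (`]-oo, x] `&` `[0, +oo[).
  rewrite /exponential_prob integral_mkcondr; apply: eq_integral => y _.
  rewrite patchE; case: ifPn => //; rewrite notin_setE/= in_itv/= andbT => /negP.
  by rewrite -ltNge => y0; rewrite lt0_exponential_pdf.
have [x0|x0] := leP x 0.
  rewrite /exponential_prob; have [x0'|x0'|xE] := ltgtP x 0.
  - rewrite (_ : _ `&` _ = set0) ?integral_set0//.
    apply/seteqP; split => // y /=; rewrite !in_itv/= andbT => -[yx y0].
    by have := le_lt_trans (le_trans y0 yx) x0'; rewrite ltxx.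
  - by move: x0; rewrite leNgt x0'.
  - rewrite xE (_ : _ `&` _ = [set 0]) ?integral_set1//.
    apply/seteqP; split => y /=; rewrite !in_itv/= andbT.
      by move=> [y0 y1]; apply/eqP; rewrite eq_le y0 y1.
    by move=> ->.
rewrite (_ : _ `&` _ = `[0, x]%classic); last first.
  apply/seteqP; split => y /=; rewrite !in_itv/= andbT.
    by move=> [-> ->].
  by move=> /andP[-> ->].
by rewrite exponential_prob_itv0c// mulN1r EFinB.
Qed.

(** Both exponentials are values of one function [phi], at [d] and at [- d], and [phi] is continuous
    at 0 with value e^-x. *)
Lemma exp_rate_cvg (R : realType) (x e : R) : 0 < x -> 0 < e ->
  exists d, [/\ 0 < d, d < 1, d * x < 1,
    expR (- x) - e <= expR (- (x * (1 + d) / (1 - d * x))) &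
    expR (- (x * (1 - d) / (1 + d * x))) <= expR (- x) + e].
Proof.
move=> x0 e0.
pose phi (d : R) := expR (- (x * (1 + d) / (1 - d * x))).
have phi0 : phi 0 = expR (- x) by rewrite /phi mul0r subr0 addr0 mulr1 divr1.
have cphi : {for 0, continuous phi}.
  rewrite /phi; continuous_step.
    exact: (continuous_addf (@continuous_cstf R R 0 1) (@continuous_idf R 0)).
  by rewrite mul0r subr0 oner_neq0.
have /cvgrPdist_le/(_ e e0)/nbhs_ballP[r /= r0 Hr] :
    phi d @[d --> 0] --> expR (- x).
  by rewrite -phi0; exact: cphi.
pose d := Num.min (r / 2) (Num.min (1 / 2) (1 / (2 * x))).
have d0 : 0 < d.
  by rewrite !lt_min !divr_gt0// mulr_gt0.
have dr : d < r by rewrite gt_min ltr_pdivrMr// ltr_pMr// ltr1n.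
have d1 : d < 1 by rewrite !gt_min; apply/orP; right; apply/orP; left; lra.
have dx : d * x < 1.
  apply: (@le_lt_trans _ _ (1 / (2 * x) * x)).
    by rewrite ler_pM2r// !ge_min lexx !orbT.
  have -> : 1 / (2 * x) * x = 1 / 2 by field; rewrite gt_eqF.
  lra.
exists d; split => //.
  have := Hr d; rewrite /ball/= sub0r normrN gtr0_norm// => /(_ dr).
  by rewrite ler_norml /phi => /andP[h1 h2]; lra.
have := Hr (- d); rewrite /ball/= sub0r opprK gtr0_norm// => /(_ dr).
rewrite ler_norml /phi mulNr opprK => /andP[h1 h2]; lra.
Qed.

Theorem proposition3p1 (R : realType) (eps : R) (eps_gt0 : 0 < eps)
  (c : R -> R -> R)
  (c0_measurable : measurable_fun [set: R] (c^~ 0))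
  (c0_ge0 : forall x : R, 0 <= c x 0)
  (c0_compact_support : compact (closure [set x | c x 0 != 0]))
  (c0_lt0 : forall x : R, x < 0 -> c x 0 = 0)
  (c0_integral :
    (0 < \int[lebesgue_measure]_(x in `]0%R, +oo[) ((1 + x) * c x 0)%:E
       < +oo)%E)
  (c_solution : whole_line_solution eps c)
  (d : measure_display) (T : R -> measurableType d)
  (P : forall t, probability (T t) R)
  (X : forall t, {RV (P t) >-> R})
  (X_pdf : forall t : R, 0 < t -> has_pdf_proportional (X t) (c^~ t))
  (d' : measure_display) (T' : measurableType d') (Q : probability T' R)
  (Y : {RV Q >-> R}) (Y_exp : is_exponential1 Y) :
  cvg_in_distribution (fun t => normalized (X t)) Y /\
  sup_norm (fun x => beta_of (c^~ t) x - 1) @[t --> +oo%R] --> 0%E.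
Proof.
have reg := solution_regular c0_measurable c0_ge0 c0_lt0 c0_integral c_solution.
have cc t (t0 : 0 < t) := solution_continuous c_solution t0.
have [m [a [b flow]]] := solution_flow_exists c0_measurable c0_ge0 c0_lt0
  c0_integral c_solution.
have beta1 := beta_eventually_near1 eps_gt0 c0_measurable c0_ge0
  c0_compact_support c0_lt0 c0_integral c_solution flow.
have w_gt0 t x (t0 : 0 < t) := solution_w_gt0 eps_gt0 c0_measurable c0_ge0
  c0_compact_support c0_lt0 c0_integral c_solution flow x t0.
have h_gt0 t (t0 : 0 < t) := solution_h0_gt0 c0_measurable c0_ge0 c0_lt0
  c0_integral c_solution t0.
split; last first.
  have sup_le e : 0 < e -> \forall t \near +oo,
      (0 <= sup_norm (fun x => beta_of (c^~ t) x - 1)%R <= e%:E)%E.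
    move=> e0; have [t0 t00 beta_le] := beta1 e e0.
    near=> t.
    have t0t : t0 <= t by near: t; apply: nbhs_pinfty_ge; exact: num_real.
    apply/andP; split.
      (* The point 1 witnesses that the supremum runs over a nonempty set, hence is non-negative. *)
      apply: (@le_trans _ _ (`|beta_of (c^~ t) 1 - 1|)%:E).
        by rewrite lee_fin.
      by apply: ereal_sup_ubound; exists 1 => //=; rewrite in_itv/= ltr01.
    apply: ge_ereal_sup => _ [x /= + <-]; rewrite in_itv/= andbT => x0.
    by rewrite lee_fin beta_le.
  apply/fine_cvgP; split.
    near=> t; have /andP[s0 s1] :
        (0 <= sup_norm (fun x => beta_of (c^~ t) x - 1)%R <= 1%:E)%E.
      by near: t; exact: sup_le.
    by rewrite ge0_fin_numE// (le_lt_trans s1)// ltry.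
  apply/cvgrPdist_le => e e0; near=> t.
  have /andP[s0 s1] :
      (0 <= sup_norm (fun x => beta_of (c^~ t) x - 1)%R <= e%:E)%E.
    by near: t; exact: sup_le.
  rewrite sub0r normrN ger0_norm ?fine_ge0//= -lee_fin fineK//.
  by rewrite ge0_fin_numE// (le_lt_trans s1)// ltry.
move=> x _; rewrite (exponential_cdf _ Y_exp).
have cdfE t : 0 < t -> cdf (normalized (X t)) x =
    cdf (X t) (x * (h_of (c^~ t) 0 / w_of (c^~ t) 0)).
  move=> t0; have [mc c0 ic] := reg t (ltW t0).
  have Xt := X_pdf t t0; have ct := cc t t0; have h0 := h_gt0 t t0.
  exact: (normalized_cdf mc ct c0 ic Xt x h0).
have mean0 t : 0 < t -> 0 < h_of (c^~ t) 0 / w_of (c^~ t) 0.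
  by move=> t0; rewrite divr_gt0// ?h_gt0 ?w_gt0.
case: ifPn => [x0|].
  apply: cvg_near_cst; near=> t.
  have t0 : 0 < t by near: t; apply: nbhs_pinfty_gt; exact: num_real.
  have [mc c0 ic] := reg t (ltW t0).
  rewrite cdfE// (density_cdf_le0 (X_pdf t t0))//.
  by rewrite pmulr_lle0// mean0.
rewrite -ltNge => x0.
apply/fine_cvgP; split.
  near=> t; have t0 : 0 < t by near: t; apply: nbhs_pinfty_gt; exact: num_real.
  have [mc c0 ic] := reg t (ltW t0).
  have xm : 0 <= x * (h_of (c^~ t) 0 / w_of (c^~ t) 0).
    by rewrite mulr_ge0// ltW// mean0.
  by rewrite cdfE// (density_cdf mc c0 ic (X_pdf t t0) xm).
(* The tolerance [dl] on beta is chosen first, from [x] and [e]; times late enough for it put w(x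
   Lambda) / w(0) within [e] of e^-x. *)
apply/cvgrPdist_le => e e0; have [dl [d0 d1 dx lo hi]] := exp_rate_cvg x0 e0.
have [t1 t10 beta_le] := beta1 dl d0.
near=> t.
have t0 : 0 < t by near: t; apply: nbhs_pinfty_gt; exact: num_real.
have t1t : t1 <= t by near: t; apply: nbhs_pinfty_ge; exact: num_real.
have [mc c0 ic] := reg t (ltW t0).
have xm : 0 <= x * (h_of (c^~ t) 0 / w_of (c^~ t) 0).
  by rewrite mulr_ge0// ltW// mean0.
rewrite /= cdfE// (density_cdf mc c0 ic (X_pdf t t0) xm)/=.
have ct := cc t t0; have wt y := w_gt0 t y t0.
have /andP[h1 h2] := tail_at_multiple_of_mean ct c0 ic wt (ltW d0) d1 x0 dx
  (h_gt0 t t0) (beta_le t t1t).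
rewrite ler_norml; apply/andP; split; lra.
Unshelve. all: by end_near. Qed.
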